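(* Let $d,n$ be positive integers. Then $$\dim_{\mathbb{C}(q)}\bigl(\mathbb{C}(q){\rm CTL}_{d,n}(q)\bigr)=\sum_{k=0}^n\binom{n}{k}^2C_k\,(d-1)^{n-k}(n-k)!.$$
   Context: Let $q$ be an indeterminate. The Yokonuma--Hecke algebra ${\rm Y}_{d,n}(q)$ is the associative unital $\mathbb{C}[q,q^{-1}]$-algebra generated by $g_1,\dots,g_{n-1},t_1,\dots,t_n$ with relations: $g_ig_j=g_jg_i$ if $|i-j|>1$; $g_ig_{i+1}g_i=g_{i+1}g_ig_{i+1}$ for $1\le i\le n-2$; $t_it_j=t_jt_i$; $t_jg_i=g_it_{s_i(j)}$ where $s_i=(i,i+1)\in\mathfrak{S}_n$; $t_j^d=1$; and $g_i^2=q+(q-1)e_ig_i$, where $e_i=\frac1d\sum_{s=0}^{d-1}t_i^st_{i+1}^{-s}$. Complex Reflection Temperley--Lieb algebra: ${\rm CTL}_{d,n}(q)={\rm Y}_{d,n}(q)/\mathfrak{I}_{d,n}$, where $\mathfrak{I}_{d,n}$ is the two-sided ideal generated by $T_1e_1e_2\,g_{1,2}$ with $T_1=\frac1d\sum_{s=0}^{d-1}t_1^s$ and $g_{1,2}=1+g_1+g_2+g_1g_2+g_2g_1+g_1g_2g_1$ (and $\mathfrak{I}_{d,n}=\{0\}$ if $n\le2$). $\mathbb{C}(q){\rm CTL}_{d,n}(q):=\mathbb{C}(q)\otimes_{\mathbb{C}[q,q^{-1}]}{\rm CTL}_{d,n}(q)$. $C_k=\frac{1}{k+1}\binom{2k}{k}$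 is the $k$-th Catalan number. When $d=1$, the convention $0^0=1$ is used. *)

(* Defs.v *)
From HB Require Import structures.
From mathcomp Require Import all_boot all_order all_algebra perm.
From mathcomp Require Import boolp reals complex.
From mathcomp Require Import xfinmap monalg.

Set Implicit Arguments.
Unset Strict Implicit.
Unset Printing Implicit Defensive.

Import GRing.Theory.
Local Open Scope ring_scope.
Local Open Scope quotient_scope.

(* An algebra over a commutative ring, as a ring with a central structure
   morphism. The library's algType requires 1 != 0, which is not available a
   priori for an algebra given by generators and relations. *)
Record alg (R : comNzRingType) := Alg {
  alg_ring :> pzRingType;
  alg_cst : {rmorphism R -> alg_ring};
  alg_central : forall (a : R) (x : alg_ring), alg_cst a * x = x * alg_cst a
}.
Arguments alg_cst {R} _.

Definition alg_mod (R : comNzRingType) (A : alg R) : Type := A.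

Section AlgMod.
Variables (R : comNzRingType) (A : alg R).

HB.instance Definition _ := GRing.Zmodule.on (alg_mod A).

Definition alg_scale (a : R) (x : alg_mod A) : alg_mod A :=
  alg_cst A a * (x : A).

Lemma alg_scaleA a b x : alg_scale a (alg_scale b x) = alg_scale (a * b) x.
Proof. by rewrite /alg_scale rmorphM mulrA. Qed.

Lemma alg_scale1r : left_id 1 alg_scale.
Proof. by move=> x; rewrite /alg_scale rmorph1 mul1r. Qed.

Lemma alg_scaleDr : right_distributive alg_scale +%R.
Proof. by move=> a x y; rewrite /alg_scale mulrDr. Qed.

Lemma alg_scaleDl x : {morph alg_scale^~ x : a b / a + b}.
Proof. by move=> a b; rewrite /alg_scale rmorphD mulrDl. Qed.

HB.instance Definition _ := GRing.Zmodule_isLmodule.Build R (alg_mod A)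
  alg_scaleA alg_scale1r alg_scaleDr alg_scaleDl.

End AlgMod.

Section FreeAlgebra.
Variables (R : comNzRingType) (I : choiceType).

Lemma free_alg_central (a : R) (x : {malg R[{fmonom I}]}) :
  a%:MP * x = x * a%:MP.
Proof.
rewrite mul_malgC malgM_def fgmulgU malgZ_def.
by apply/eq_bigr => k _; rewrite mulm1 mulrC.
Qed.

Definition free_alg : alg R := @Alg R _ (@malgC {fmonom I} R) free_alg_central.

Definition free_gen (i : I) : free_alg := << fmu i >>.

End FreeAlgebra.

Section QuotientAlgebra.
Variables (R : comNzRingType) (A : alg R).

Inductive ideal_gen (S : A -> Prop) : A -> Prop :=
| IdealGen x : S x -> ideal_gen S x
| Ideal0 : ideal_gen S 0
| IdealB x y : ideal_gen S x -> ideal_gen S y -> ideal_gen S (x - y)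
| IdealMl a x : ideal_gen S x -> ideal_gen S (a * x)
| IdealMr a x : ideal_gen S x -> ideal_gen S (x * a).

Variable S : A -> Prop.

Definition ideal_pred : {pred A} := fun x => `[< ideal_gen S x >].

Lemma ideal_predP x : reflect (ideal_gen S x) (x \in ideal_pred).
Proof. exact: asboolP. Qed.

Lemma ideal_pred_zmod : zmod_closed ideal_pred.
Proof.
split; first by apply/ideal_predP; apply: Ideal0.
by move=> x y /ideal_predP ? /ideal_predP ?; apply/ideal_predP; apply: IdealB.
Qed.

HB.instance Definition _ := GRing.isZmodClosed.Build A ideal_pred
  ideal_pred_zmod.

Definition quot_ring : Type := Quotient.quot (ideal_pred : zmodClosed A).

HB.instance Definition _ := GRing.Zmodule.on quot_ring.
HB.instance Definition _ := Quotient.on quot_ring.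

Definition quot_pi (x : A) : quot_ring := \pi x.

Lemma quot_piP x y : quot_pi x = quot_pi y <-> ideal_gen S (x - y).
Proof.
rewrite /quot_pi; split=> [/eqP|h].
  by rewrite -Quotient.idealrBE => /ideal_predP.
by apply/eqP; rewrite -Quotient.idealrBE; apply/ideal_predP.
Qed.

Lemma quot_reprK (x : quot_ring) : quot_pi (repr x) = x.
Proof. exact: reprK. Qed.

Lemma quot_piB : {morph quot_pi : x y / x - y}.
Proof.
move=> x y; rewrite /quot_pi.
exact: (raddfB (\pi_(Quotient.quot (ideal_pred : zmodClosed A)))).
Qed.

Definition quot_one : quot_ring := quot_pi 1.
Definition quot_mul (x y : quot_ring) : quot_ring :=
  quot_pi (repr x * repr y).

Lemma quot_piM x y : quot_pi (x * y) = quot_mul (quot_pi x) (quot_pi y).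
Proof.
apply/quot_piP; set x' := repr _; set y' := repr _.
have Hx : ideal_gen S (x - x') by apply/quot_piP; rewrite quot_reprK.
have Hy : ideal_gen S (y - y') by apply/quot_piP; rewrite quot_reprK.
rewrite (_ : _ - _ = (x - x') * y - (x' * - (y - y'))).
  by apply: IdealB; [apply: IdealMr | rewrite mulrN -mulNr; apply: IdealMl].
by rewrite mulrN opprK mulrBl mulrBr addrA subrK.
Qed.

HB.instance Definition _ := GRing.isZmodMorphism.Build A quot_ring quot_pi
  quot_piB.

Lemma quot_mulA : associative quot_mul.
Proof.
by move=> x y z; rewrite -[x]quot_reprK -[y]quot_reprK -[z]quot_reprK
  -!quot_piM mulrA.
Qed.

Lemma quot_mul1r : left_id quot_one quot_mul.
Proof. by move=> x; rewrite -[x]quot_reprK -quot_piM mul1r. Qed.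

Lemma quot_mulr1 : right_id quot_one quot_mul.
Proof. by move=> x; rewrite -[x]quot_reprK -quot_piM mulr1. Qed.

Lemma quot_mulDl : left_distributive quot_mul +%R.
Proof.
move=> x y z; rewrite -[x]quot_reprK -[y]quot_reprK -[z]quot_reprK.
by rewrite -raddfD -!quot_piM mulrDl raddfD.
Qed.

Lemma quot_mulDr : right_distributive quot_mul +%R.
Proof.
move=> x y z; rewrite -[x]quot_reprK -[y]quot_reprK -[z]quot_reprK.
by rewrite -raddfD -!quot_piM mulrDr raddfD.
Qed.

HB.instance Definition _ := GRing.Zmodule_isPzRing.Build quot_ring
  quot_mulA quot_mul1r quot_mulr1 quot_mulDl quot_mulDr.

Lemma quot_pi_monoid : monoid_morphism quot_pi.
Proof. by split=> // x y; apply: quot_piM. Qed.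

HB.instance Definition _ := GRing.isMonoidMorphism.Build A quot_ring quot_pi
  quot_pi_monoid.

Lemma quot_central (a : R) (x : quot_ring) :
  (quot_pi \o alg_cst A) a * x = x * (quot_pi \o alg_cst A) a.
Proof. by rewrite -[x]quot_reprK /= -!rmorphM alg_central. Qed.

Definition quot_alg : alg R :=
  @Alg R quot_ring (quot_pi \o alg_cst A) quot_central.

End QuotientAlgebra.

Section BaseChange.
Variables (R K : comNzRingType) (iota : {rmorphism R -> K}) (M : lmodType R).
Local Notation KM := (K * M)%type.

(* The tensor product of K and M over R, where R acts on K through iota: the
   free abelian group on K * M, modulo the usual relations. *)
Inductive tensor_rel : {malg KM} -> Prop :=
| TensorDl a b m :
    tensor_rel (<< ((a + b, m) : KM) >> - << (a, m) >> - << (b, m) >>)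
| TensorDr a m m' :
    tensor_rel (<< ((a, m + m') : KM) >> - << (a, m) >> - << (a, m') >>)
| TensorZ a r m :
    tensor_rel (<< ((a * iota r, m) : KM) >> - << (a, r *: m) >>).

Inductive tensor_null : {malg KM} -> Prop :=
| TensorRel x : tensor_rel x -> tensor_null x
| Tensor0 : tensor_null 0
| TensorB x y : tensor_null x -> tensor_null y -> tensor_null (x - y).

Definition tensor_pred : {pred {malg KM}} := fun x => `[< tensor_null x >].

Lemma tensor_predP x : reflect (tensor_null x) (x \in tensor_pred).
Proof. exact: asboolP. Qed.

Lemma tensor_pred_zmod : zmod_closed tensor_pred.
Proof.
split; first by apply/tensor_predP; apply: Tensor0.
move=> x y /tensor_predP ? /tensor_predP ?.
by apply/tensor_predP; apply: TensorB.
Qed.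

HB.instance Definition _ := GRing.isZmodClosed.Build {malg KM} tensor_pred
  tensor_pred_zmod.

Definition base_change : Type :=
  Quotient.quot (tensor_pred : zmodClosed {malg KM}).

HB.instance Definition _ := GRing.Zmodule.on base_change.
HB.instance Definition _ := Quotient.on base_change.

Definition tensor_pi (x : {malg KM}) : base_change := \pi x.

Definition tensor (a : K) (m : M) : base_change := tensor_pi << (a, m) >>.

Lemma tensor_piP x y : tensor_pi x = tensor_pi y <-> tensor_null (x - y).
Proof.
rewrite /tensor_pi; split=> [/eqP|h].
  by rewrite -Quotient.idealrBE => /tensor_predP.
by apply/eqP; rewrite -Quotient.idealrBE; apply/tensor_predP.
Qed.

Lemma tensor_reprK (x : base_change) : tensor_pi (repr x) = x.
Proof. exact: reprK. Qed.

Lemma tensor_piB : {morph tensor_pi : x y / x - y}.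
Proof.
move=> x y; rewrite /tensor_pi.
exact: (raddfB (\pi_(Quotient.quot (tensor_pred : zmodClosed {malg KM})))).
Qed.

HB.instance Definition _ := GRing.isZmodMorphism.Build {malg KM}
  base_change tensor_pi tensor_piB.

(* The additive extension of (b, m) |-> (c * b, m). *)
Definition tensor_act (c : K) (x : {malg KM}) : {malg KM} :=
  \sum_(k <- msupp x) << x@_k *g (c * k.1, k.2) >>.

Lemma tensor_actEw c x (d : {fset KM}) : (msupp x `<=` d)%fset ->
  tensor_act c x = \sum_(k <- d) << x@_k *g (c * k.1, k.2) >>.
Proof.
move=> le; rewrite /tensor_act (big_fset_incl _ le) //= => k _.
by move=> /mcoeff_outdom ->; rewrite monalgU0.
Qed.

Lemma tensor_act_zmod c : zmod_morphism (tensor_act c).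
Proof.
move=> x y; set d := (msupp x `|` msupp y)%fset.
rewrite (@tensor_actEw c x d) ?fsubsetUl // (@tensor_actEw c y d) ?fsubsetUr //.
rewrite (@tensor_actEw c (x - y) d) ?msuppB_le // -sumrB.
by apply/eq_bigr => k _; rewrite mcoeffB monalgUB.
Qed.

HB.instance Definition _ c := GRing.isZmodMorphism.Build {malg KM}
  {malg KM} (tensor_act c) (tensor_act_zmod c).

Lemma tensor_actU c z (k : KM) :
  tensor_act c << z *g k >> = << z *g (c * k.1, k.2) >>.
Proof.
by rewrite (tensor_actEw c msuppU_le) big_seq_fset1 mcoeffUU.
Qed.

Lemma tensor_null_act c x : tensor_null x -> tensor_null (tensor_act c x).
Proof.
elim=> [{}x [a b m|a m m'|a r m]||y z _ ny _ nz].
- rewrite !raddfB /= !tensor_actU /= mulrDr.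
  exact/TensorRel/TensorDl.
- rewrite !raddfB /= !tensor_actU /=.
  exact/TensorRel/TensorDr.
- rewrite !raddfB /= !tensor_actU /= mulrA.
  exact/TensorRel/TensorZ.
- rewrite raddf0; exact: Tensor0.
- rewrite raddfB; exact: TensorB.
Qed.

Definition base_change_scale (c : K) (x : base_change) : base_change :=
  tensor_pi (tensor_act c (repr x)).

Lemma base_change_scale_pi c x :
  base_change_scale c (tensor_pi x) = tensor_pi (tensor_act c x).
Proof.
apply/tensor_piP; rewrite -raddfB; apply/tensor_null_act/tensor_piP.
exact: tensor_reprK.
Qed.

Lemma tensor_genP (f g : {additive {malg KM} -> base_change}) :
  (forall a m, f << (a, m) >> = g << (a, m) >>) -> f =1 g.
Proof.
move=> fg x; rewrite [x]monalgE !raddf_sum; apply: eq_bigr => -[a m] _.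
by rewrite -[x@_(a, m)]intz !raddfMz fg.
Qed.

Lemma base_change_scaleDr : right_distributive base_change_scale +%R.
Proof.
move=> c x y; rewrite -[x]tensor_reprK -[y]tensor_reprK -raddfD.
by rewrite !base_change_scale_pi !raddfD.
Qed.

Lemma base_change_scaleA a b x :
  base_change_scale a (base_change_scale b x) = base_change_scale (a * b) x.
Proof.
rewrite -[x]tensor_reprK !base_change_scale_pi.
apply: (tensor_genP (f := tensor_pi \o tensor_act a \o tensor_act b)
  (g := tensor_pi \o tensor_act (a * b))) => c m /=.
by rewrite !tensor_actU /= mulrA.
Qed.

Lemma base_change_scale1r : left_id 1 base_change_scale.
Proof.
move=> x; rewrite -[x]tensor_reprK !base_change_scale_pi.
apply: (tensor_genP (f := tensor_pi \o tensor_act 1) (g := tensor_pi)) => c m /=.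
by rewrite !tensor_actU /= mul1r.
Qed.

Lemma base_change_scaleDl x : {morph base_change_scale^~ x : a b / a + b}.
Proof.
move=> a b; rewrite -[x]tensor_reprK !base_change_scale_pi.
apply: (tensor_genP (f := tensor_pi \o tensor_act (a + b))
  (g := (tensor_pi \o tensor_act a) \+ (tensor_pi \o tensor_act b))) => c m /=.
rewrite !tensor_actU /= mulrDl -raddfD; apply/tensor_piP.
by rewrite opprD addrA; apply/TensorRel/TensorDl.
Qed.

HB.instance Definition _ := GRing.Zmodule_isLmodule.Build K base_change
  base_change_scaleA base_change_scale1r base_change_scaleDr base_change_scaleDl.

End BaseChange.

Definition has_dim (K : fieldType) (V : lmodType K) (N : nat) : Prop :=
  exists b : 'I_N -> V,
    (forall c : 'I_N -> K, \sum_i c i *: b i = 0 -> forall i, c i = 0) /\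
    (forall v, exists c : 'I_N -> K, v = \sum_i c i *: b i).

Section Laurent.
Variable F : fieldType.

Definition ratfun := {fraction {poly F}}.

HB.instance Definition _ := GRing.Field.on ratfun.

Definition qvar : ratfun := @FracField.tofrac {poly F} 'X.

(* F[q, q^-1] as the subring of F(q) of the fractions p / q ^+ m. *)
Definition laurent_pred : {pred ratfun} := fun f =>
  `[< exists (p : {poly F}) (m : nat), f = FracField.tofrac p / qvar ^+ m >].

Lemma laurent_predP f :
  reflect (exists (p : {poly F}) (m : nat), f = FracField.tofrac p / qvar ^+ m)
    (f \in laurent_pred).
Proof. exact: asboolP. Qed.

Lemma qvar_neq0 : qvar != 0.
Proof. by rewrite tofrac_eq0 polyX_eq0. Qed.

Lemma laurent_subring : subring_closed laurent_pred.
Proof.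
have q0 m : qvar ^+ m != 0 by rewrite expf_neq0 ?qvar_neq0.
split.
- by apply/laurent_predP; exists 1, 0%N; rewrite tofrac1 divr1.
- move=> _ _ /laurent_predP[p [m ->]] /laurent_predP[r [k ->]].
  apply/laurent_predP; exists (p * 'X^k - r * 'X^m), (m + k)%N.
  rewrite tofracB !tofracM !tofracXn -!/qvar exprD -mulNr addf_div //.
  by rewrite mulNr.
- move=> _ _ /laurent_predP[p [m ->]] /laurent_predP[r [k ->]].
  apply/laurent_predP; exists (p * r), (m + k)%N.
  by rewrite tofracM exprD mulf_div.
Qed.

HB.instance Definition _ := GRing.isSubringClosed.Build ratfun laurent_pred
  laurent_subring.

Record laurent := Laurent {
  laurent_val :> ratfun;
  laurent_valP : laurent_val \in laurent_pred
}.

HB.instance Definition _ := [isSub for laurent_val].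
HB.instance Definition _ := [Choice of laurent by <:].
HB.instance Definition _ := [SubChoice_isSubComNzRing of laurent by <:].

Lemma laurent_q_subproof : qvar \in laurent_pred.
Proof. by apply/laurent_predP; exists 'X, 0%N; rewrite divr1. Qed.

Definition laurent_q : laurent := Laurent laurent_q_subproof.

Lemma laurent_const_subproof (c : F) :
  @FracField.tofrac {poly F} c%:P \in laurent_pred.
Proof. by apply/laurent_predP; exists c%:P, 0%N; rewrite divr1. Qed.

Definition laurent_const (c : F) : laurent := Laurent (laurent_const_subproof c).

End Laurent.

Section YokonumaHecke.
Variables (F : fieldType) (d n : nat).

(* Indices are shifted by one: i : 'I_n.-1 stands for g_(i+1) and j : 'I_n for
   t_(j+1). The two positions exchanged by s_i are posl i and posr i. *)
Definition posl (i : 'I_n.-1) : 'I_n := widen_ord (leq_pred n) i.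

Lemma posr_subproof (i : 'I_n.-1) : (i.+1 < n)%N.
Proof. by rewrite -ltn_predRL. Qed.

Definition posr (i : 'I_n.-1) : 'I_n := Ordinal (posr_subproof i).

(* The idempotent e_i computed from elements t of an algebra; since t_j ^+ d = 1,
   the inverse of t_j is written t_j ^+ d.-1. *)
Definition idem_e (A : alg (laurent F)) (t : 'I_n -> A) (i : 'I_n.-1) : A :=
  alg_cst A (laurent_const d%:R^-1) *
    \sum_(s < d) t (posl i) ^+ s * (t (posr i) ^+ d.-1) ^+ s.

Definition yh_free : alg (laurent F) := free_alg (laurent F) ('I_n.-1 + 'I_n)%type.

Definition free_g (i : 'I_n.-1) : yh_free := free_gen (laurent F) (inl i).
Definition free_t (j : 'I_n) : yh_free := free_gen (laurent F) (inr j).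

(* A relation u = v is recorded as the element u - v. *)
Inductive yh_rel : yh_free -> Prop :=
| YHComm (i j : 'I_n.-1) : (i.+1 < j)%N || (j.+1 < i)%N ->
    yh_rel (free_g i * free_g j - free_g j * free_g i)
| YHBraid (i j : 'I_n.-1) : j = i.+1 :> nat ->
    yh_rel (free_g i * free_g j * free_g i - free_g j * free_g i * free_g j)
| YHTT (i j : 'I_n) :
    yh_rel (free_t i * free_t j - free_t j * free_t i)
| YHTG (i : 'I_n.-1) (j : 'I_n) :
    yh_rel (free_t j * free_g i
            - free_g i * free_t (tperm (posl i) (posr i) j))
| YHTd (j : 'I_n) :
    yh_rel (free_t j ^+ d - 1)
| YHQuad (i : 'I_n.-1) :
    yh_rel (free_g i ^+ 2
            - (alg_cst yh_free (laurent_q F)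
               + alg_cst yh_free (laurent_q F - 1) * idem_e free_t i * free_g i)).

Definition yokonuma_hecke : alg (laurent F) := quot_alg yh_rel.

Definition yh_g (i : 'I_n.-1) : yokonuma_hecke := quot_pi yh_rel (free_g i).
Definition yh_t (j : 'I_n) : yokonuma_hecke := quot_pi yh_rel (free_t j).

Definition idem_T (j : 'I_n) : yokonuma_hecke :=
  alg_cst yokonuma_hecke (laurent_const d%:R^-1) * \sum_(s < d) yh_t j ^+ s.

Definition g12 (i j : 'I_n.-1) : yokonuma_hecke :=
  1 + yh_g i + yh_g j + yh_g i * yh_g j + yh_g j * yh_g i
    + yh_g i * yh_g j * yh_g i.

(* There is no such generator when n <= 2, so the ideal is then zero. *)
Inductive ctl_rel : yokonuma_hecke -> Prop :=
| CTLRel (j : 'I_n) (i1 i2 : 'I_n.-1) :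
    j = 0%N :> nat -> i1 = 0%N :> nat -> i2 = 1%N :> nat ->
    ctl_rel (idem_T j * idem_e yh_t i1 * idem_e yh_t i2 * g12 i1 i2).

Definition ctl : alg (laurent F) := quot_alg ctl_rel.

Definition ctl_ratfun : lmodType (ratfun F) :=
  base_change (val : {rmorphism laurent F -> ratfun F}) (alg_mod ctl).

End YokonumaHecke.

Definition catalan (k : nat) : nat := ('C(k.*2, k) %/ k.+1)%N.

Lemma catalanE k : (k.+1 * catalan k = 'C(k.*2, k))%N.
Proof.
suff dvd : (k.+1 %| 'C(k.*2, k))%N by rewrite /catalan mulnC divnK.
have H : (k.+1 * 'C(k.*2, k.+1) = k * 'C(k.*2, k))%N.
  by rewrite mul_bin_left -addnn addnK.
by have := dvdn_mulr 'C(k.*2, k.+1) (dvdnn k.+1);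
  rewrite H Gauss_dvdr // coprimeSn.
Qed.

(* Main.v *)
Require Import Defs.
From HB Require Import structures.
From mathcomp Require Import all_boot all_order all_algebra.
From mathcomp Require Import perm cyclic separable cyclotomic.
From mathcomp Require Import reals complex.
From mathcomp Require Import boolp xfinmap monalg.
From mathcomp Require Import zify ring.

(** Write [E psi] for the idempotent of the [t_j] attached to a colouring
    [psi] of the positions by characters of Z/d, and [g_p] for the product of
    the [g_i] along a reduced word of the permutation [p].  The [E psi * g_p]
    span the Yokonuma-Hecke algebra.  In the quotient, [E psi * g_p] becomes a
    combination of shorter elements as soon as [p] has a 321-pattern at three
    positions of colour zero: either a descent can be split off while keeping
    the pattern, or the pattern sits at adjacent positions, where it is killed
    by a conjugate of the defining relation.  Hence the pairs [(psi, p)]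
    without such a pattern span.

    They are free by letting the algebra act on words whose letters carry a
    colour, with only two letters of colour zero: the sign convention makes
    [g_i] act by -1 on a repeated letter, so the generator of the ideal, a
    q-symmetrizer on three strands of colour zero, acts by 0.  Marking the
    left-to-right maxima among the strands of colour zero, a pair [(psi, p)]
    without pattern yields words [z] and [u] such that [p] is the unique
    shortest permutation carrying [u] to [z]; the corresponding matrix
    coefficient is a power of [q] on [E psi * g_p] and vanishes on all other
    basis elements that are not longer.

    The pairs are counted by inserting the largest value into a 321-avoiding
    sequence: a sequence whose maximal increasing suffix has length [r] has
    [r + 1] such insertions, which gives ballot numbers. *)

Set Implicit Arguments.
Unset Strict Implicit.
Unset Printing Implicit Defensive.

Import GRing.Theory.

(** * Reduced words in the symmetric group *)

Section Perms.
Variable n : nat.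
Implicit Types (i j : 'I_n.-1) (p v : 'S_n).

Definition adj i : 'S_n := tperm (posl i) (posr i).

Definition desc i p := (p (posr i) < p (posl i))%N.

Definition inv_set p : {set 'I_n * 'I_n} :=
  [set x : 'I_n * 'I_n | (x.1 < x.2)%N && (p x.2 < p x.1)%N].
Definition ninv p := #|inv_set p|.

Lemma posl_lt_posr i : (posl i < posr i)%N.
Proof. exact: ltnSn. Qed.

Lemma posl_neq i : posl i != posr i.
Proof. by rewrite neq_ltn posl_lt_posr. Qed.

Lemma adjK i : (adj i * adj i = 1)%g.
Proof. exact: tperm2. Qed.

Lemma adjKl i : involutive (adj i).
Proof. exact: tpermK. Qed.

Lemma mul_adjK i p : (adj i * (adj i * p) = p)%g.
Proof. by rewrite mulgA adjK mul1g. Qed.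

Lemma adjE i (x : 'I_n) :
  nat_of_ord (adj i x) = if (x : nat) == i then i.+1 else if (x : nat) == i.+1 then (i
    : nat) else x.
Proof.
rewrite /adj permE /= -!val_eqE /=.
by case: ifP => [_|_]; [|case: ifP].
Qed.

Lemma adj_lt i (x y : 'I_n) :
  (x < y)%N -> (x, y) != (posl i, posr i) -> (adj i x < adj i y)%N.
Proof.
rewrite -pair_eqE /pair_eq /= -!val_eqE /= !adjE.
by do ![case: ifP]; lia.
Qed.

Lemma adj_posl i : adj i (posl i) = posr i.
Proof. exact: tpermL. Qed.

Lemma adj_posr i : adj i (posr i) = posl i.
Proof. exact: tpermR. Qed.

Lemma desc_adj i p : desc i (adj i * p) = ~~ desc i p.
Proof.
rewrite /desc !permM adj_posl adj_posr -leqNgt ltn_neqAle.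
by case: eqP => // /ord_inj/perm_inj h; have := posl_neq i; rewrite h eqxx.
Qed.

(** Among pairs of increasing positions, [adj i] reverses only [(posl i, posr i)]. Hence it carries
    the inversions of [p] bijectively to those of [adj i * p] other than that pair. *)
Lemma ninv_adj i p : ~~ desc i p -> ninv (adj i * p) = (ninv p).+1.
Proof.
move=> nd; pose f (x : 'I_n * 'I_n) := (adj i x.1, adj i x.2).
have fK : involutive f by case=> a b; rewrite /f /= !adjKl.
have -> : ninv (adj i * p) = #|(posl i, posr i) |: f @: inv_set p|.
  apply: eq_card => -[a b]; rewrite 2!inE.
  have -> : ((a, b) \in f @: inv_set p) = ((adj i a, adj i b) \in inv_set p).
    by rewrite -[(a, b)]fK (mem_imset _ _ (can_inj fK)).
  rewrite !inE /= !permM; case: (eqVneq (a, b) (posl i, posr i)) => [[-> ->]|ne].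
    have := desc_adj i p; rewrite nd /desc !permM => -> /=.
    by rewrite posl_lt_posr.
  rewrite orFb; have [hp|] := boolP (p (adj i b) < p (adj i a))%N;
    rewrite ?andbF ?andbT //.
  apply/idP/idP => h; first exact: adj_lt.
  have := @adj_lt i _ _ h; rewrite !adjKl; apply.
  by apply: contraNneq nd => -[ha hb]; rewrite /desc -ha -hb.
rewrite cardsU1 (card_imset _ (can_inj fK)) -/(ninv p).
suff -> : (posl i, posr i) \notin f @: inv_set p by [].
apply/imsetP => -[[c e]]; rewrite inE => /andP[/= lt_ce _].
rewrite /f /= => -[hc he]; move: lt_ce.
by rewrite -(adjKl i c) -(adjKl i e) -hc -he adj_posl adj_posr ltnNge ltnW //
  posl_lt_posr.
Qed.

Lemma ninv_desc i p : desc i p -> ninv p = (ninv (adj i * p)).+1.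
Proof.
by move=> dp; rewrite -{1}(mul_adjK i p) ninv_adj // desc_adj negbK.
Qed.

(** Walk from [a] towards [b]: as long as there is no descent at [a], the pair formed by the next
    position and [b] is still an inversion. *)
Lemma desc_between p (a b : 'I_n) : (a < b)%N -> (p b < p a)%N ->
  exists i, [/\ (a <= posl i)%N, (posr i <= b)%N & desc i p].
Proof.
move: {2}(b - a)%N (leqnn (b - a)) => k; elim: k a => [|k IH] a; first lia.
move=> le_ab lt_ab lt_p; have lt_an : (a < n.-1)%N by have := ltn_ord b; lia.
pose i := Ordinal lt_an; have ea : a = posl i by apply: val_inj.
have [di|ndi] := boolP (desc i p).
  by exists i; split => //; rewrite ea.
have lt2 : (posr i < b)%N.
  rewrite ltn_neqAle -ltnS ltnS lt_ab andbT; apply: contraNneq ndi => h.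
  have eb : posr i = b by apply: val_inj.
  by rewrite /desc eb -ea.
have [||j [h1 h2 h3]] := IH (posr i) _ lt2.
- by rewrite /= ; lia.
- by apply: leq_trans lt_p _; rewrite ea; move: ndi; rewrite /desc -leqNgt.
by exists j; split => //; apply: leq_trans h1; rewrite /= ltnW.
Qed.

(* Right composition with a word [y : 'I_n -> L] describes the action of
   permutations on words. *)
Definition incr_on (L : eqType) (z : 'I_n -> L) p :=
  forall a b : 'I_n, (a < b)%N -> z a = z b -> (p a < p b)%N.

(** If [v j < p j], then [p] takes the value [v j] at a position [k] with the same letter, and
    [k < j] by monotonicity. There [p] and [v] agree, against the injectivity of [v]. *)
Lemma incr_on_unique_le (L : eqType) (y : 'I_n -> L) p v :
  y \o p =1 y \o v -> incr_on (y \o p) p -> incr_on (y \o p) v ->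
  forall j : 'I_n, (forall k : 'I_n, (k < j)%N -> p k = v k) -> (p j <= v j)%N.
Proof.
move=> yE incp incv j IH; rewrite leqNgt; apply/negP => lt.
pose k := (p^-1)%g (v j).
have pk : p k = v j by rewrite permKV.
have zk : (y \o p) k = (y \o p) j by rewrite [RHS]yE /= pk.
have kj : (k < j)%N.
  rewrite ltnNge leq_eqVlt; apply/negP => /orP[/eqP/ord_inj h|h].
    by move: lt; rewrite -pk -h ltnn.
  by have := incp _ _ h (esym zk); rewrite pk ltnNge ltnW.
have := IH _ kj; rewrite pk => /perm_inj h; by rewrite h ltnn in kj.
Qed.

Lemma incr_on_unique (L : eqType) (y : 'I_n -> L) p v :
  y \o p =1 y \o v -> incr_on (y \o p) p -> incr_on (y \o p) v -> p = v.
Proof.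
move=> yE incp incv; apply/permP => j.
have yE' : y \o v =1 y \o p by move=> x; rewrite yE.
have conv u : incr_on (y \o p) u -> incr_on (y \o v) u.
  by move=> h a b lt; rewrite -![(y \o v) _]yE; apply: h.
have [m] := ubnP (j : nat); elim: m j => // m IH j /ltnSE le_jm.
have IHj (k : 'I_n) : (k < j)%N -> p k = v k by move=> lt; apply: IH;
  apply: leq_trans le_jm.
apply/ord_inj/eqP; rewrite eqn_leq (incr_on_unique_le yE incp incv IHj).
apply: (incr_on_unique_le yE' (conv _ incv) (conv _ incp)) => k /IHj.
exact: esym.
Qed.

(** Induction on [b - a]: with [posl i = a], the transposition [tperm a b] is the conjugate by
    [adj i] of that of [posr i] and [b], so only the change of length under [adj i] has to be
    followed. *)
Lemma ninv_transp v (a b : 'I_n) : (a < b)%N -> (v b < v a)%N ->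
  (ninv (tperm a b * v) < ninv v)%N.
Proof.
move: {2}(b - a)%N (leqnn (b - a)) => k; elim: k a v => [|k IH] a v; first lia.
move=> le_ab lt_ab lt_v; have lt_an : (a < n.-1)%N by have := ltn_ord b; lia.
pose i := Ordinal lt_an; have ea : a = posl i by apply: val_inj.
have [eb|neb] := eqVneq (posr i) b.
  have dv : desc i v by rewrite /desc eb -ea.
  by rewrite (ninv_desc dv) /adj -ea eb.
have lt2 : (posr i < b)%N by rewrite ltn_neqAle -val_eqE /= in neb *; rewrite neb.
pose u := (adj i * v)%g; pose t' := tperm (posr i) b.
have nlb : posl i != b by rewrite -ea neq_ltn lt_ab.
have ub : u b = v b by rewrite permM /adj tpermD.
have tE : (tperm a b = adj i * (t' * adj i))%g.
  have -> : (adj i * (t' * adj i) = t' ^ adj i)%g by rewrite conjgE /adj tpermV.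
  by rewrite /t' tpermJ adj_posr ea /adj tpermD.
have IHu : (u b < u (posr i))%N -> (ninv (t' * u) < ninv u)%N.
  by move=> h; apply: IH; rewrite //= ; lia.
have tv : (tperm a b * v = adj i * (t' * u))%g by rewrite tE /u !mulgA.
have up : (ninv (adj i * (t' * u)) <= (ninv (t' * u)).+1)%N.
  by have [h|h] := boolP (desc i (t' * u)); [rewrite (ninv_desc h);
    lia | rewrite ninv_adj].
have u1 : u (posr i) = v a by rewrite permM adj_posr ea.
have u0 : u (posl i) = v (posr i) by rewrite permM adj_posl.
have [dv|ndv] := boolP (desc i v).
  rewrite tv (ninv_desc dv) -/u.
  by apply: leq_ltn_trans up _; rewrite ltnS; apply: IHu; rewrite ub u1.
(* Without a descent at [i], [u] is longer than [v] by one. But [v b < v (posr i)] makes [i] a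
   descent of [t' * u], so the outer [adj i] gains that unit back. *)
have lt3 : (v b < v (posr i))%N.
  by apply: leq_trans lt_v _; rewrite ea; move: ndv; rewrite /desc -leqNgt.
have hd : desc i (t' * u).
  rewrite /desc (permM t' u (posl i)) (permM t' u (posr i)) tpermL.
  by rewrite tpermD ?ub ?u0 // eq_sym ?posl_neq.
have := ninv_desc hd; rewrite -tv => e1.
have := ninv_adj ndv; rewrite -/u => e2.
have := IHu; rewrite ub u1 => /(_ lt_v); lia.
Qed.

(** The permutation that is increasing on equal letters is the unique shortest one producing its
    word: any other has an inversion between equal letters, and exchanging these shortens it without
    changing the word. *)
Lemma ninv_incr_min (L : eqType) (y : 'I_n -> L) p v :
  incr_on (y \o p) p -> y \o p =1 y \o v ->
  (ninv p <= ninv v)%N /\ (ninv p = ninv v -> p = v).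
Proof.
move=> incp; have [m] := ubnP (ninv v); elim: m v => // m IH v /ltnSE le_vm yE.
have [->|nepv] := eqVneq p v; first by [].
suff [a [b [ltab zab ltv]]] : exists a b : 'I_n,
    [/\ (a < b)%N, y (p a) = y (p b) & (v b < v a)%N].
  have lt := ninv_transp ltab ltv.
  have [||h1 _] := IH (tperm a b * v)%g.
  - exact: leq_trans lt le_vm.
  - move=> x /=; rewrite permM -[RHS]yE /=.
    by case: tpermP => [->|->|] //; rewrite zab.
  by split; [exact: leq_trans h1 (ltnW lt) | move=> e; move: (leq_ltn_trans h1 lt);
    rewrite e ltnn].
apply: contrapT => h; case/eqP: nepv; apply: (incr_on_unique yE incp) => a b lt zab.
rewrite ltnNge leq_eqVlt; apply/negP => /orP[/eqP/ord_inj/perm_inj e|lt'].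
  by rewrite e ltnn in lt.
by apply: h; exists a, b.
Qed.

End Perms.

(** * Reduced words and descents *)

Section Words.
Variable n : nat.
Implicit Types (i j : 'I_n.-1) (p v : 'S_n) (s : seq 'I_n.-1).

Definition pword s : 'S_n := (\prod_(i <- s) adj i)%g.

Definition reduced s := ninv (pword s) == size s.

Lemma pword_cons i s : pword (i :: s) = (adj i * pword s)%g.
Proof. by rewrite /pword big_cons. Qed.

Lemma pword_nil : pword [::] = 1%g.
Proof. by rewrite /pword big_nil. Qed.

Lemma ninv_1 : ninv (1 : 'S_n)%g = 0%N.
Proof.
apply/eqP; rewrite /ninv cards_eq0; apply/eqP/setP => -[a b].
by rewrite !inE /= !perm1; case: ltngtP.
Qed.

Lemma ninv_adj_le i p : (ninv (adj i * p) <= (ninv p).+1)%N.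
Proof.
have [h|h] := boolP (desc i p); last by rewrite ninv_adj.
by rewrite (ninv_desc h); lia.
Qed.

Lemma ninv_pword s : (ninv (pword s) <= size s)%N.
Proof.
elim: s => [|i s IH]; first by rewrite pword_nil ninv_1.
by rewrite pword_cons; apply: leq_trans (ninv_adj_le _ _) _.
Qed.

Lemma reduced_cons i s :
  reduced (i :: s) = reduced s && ~~ desc i (pword s).
Proof.
rewrite /reduced pword_cons /=; have [h|h] := boolP (desc i _).
  rewrite andbF; apply/negbTE; rewrite neq_ltn.
  by have := ninv_desc h; have := ninv_pword s; lia.
by rewrite ninv_adj // eqSS andbT.
Qed.

Lemma ninv0 p : (forall i, ~~ desc i p) -> p = 1%g.
Proof.
(* On the constant word, [incr_on] means increasing, and only the identity is increasing. *)
move=> nd; apply: (@incr_on_unique _ _ (fun=> tt)) => // a b lt _ /=;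
  last by rewrite !perm1.
rewrite ltnNge leq_eqVlt; apply/negP => /orP[/eqP/ord_inj/perm_inj e|lt'].
  by rewrite e ltnn in lt.
by have [i [_ _]] := desc_between lt lt'; apply/negP.
Qed.

Lemma reduced_word_exists p : exists s, reduced s && (pword s == p).
Proof.
have [m] := ubnP (ninv p); elim: m p => // m IH p /ltnSE le_pm.
have [i di|nd] := pickP (fun i => desc i p); last first.
  exists [::]; rewrite /reduced pword_nil ninv_1 (@ninv0 p) ?eqxx //.
  by move=> i; rewrite nd.
have [|s /andP[rs /eqP es]] := IH (adj i * p)%g.
  by rewrite -(ninv_desc di).
exists (i :: s); rewrite reduced_cons rs pword_cons es mul_adjK eqxx.
by rewrite desc_adj di.
Qed.

Definition rword p := xchoose (reduced_word_exists p).

Lemma rword_reduced p : reduced (rword p).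
Proof. by have /andP[] := xchooseP (reduced_word_exists p). Qed.

Lemma pword_rword p : pword (rword p) = p.
Proof. by have /andP[_ /eqP] := xchooseP (reduced_word_exists p). Qed.

Lemma size_rword p : size (rword p) = ninv p.
Proof. by rewrite -(eqP (rword_reduced p)) pword_rword. Qed.

Lemma desc_adj_far i j p : (i.+1 < j)%N || (j.+1 < i)%N ->
  desc i (adj j * p) = desc i p.
Proof.
move=> far; rewrite /desc !permM.
have e1 : adj j (posl i) = posl i by rewrite /adj tpermD // -val_eqE /=; lia.
have e2 : adj j (posr i) = posr i by rewrite /adj tpermD // -val_eqE /=; lia.
by rewrite e1 e2.
Qed.

Lemma adj_far i j : (i.+1 < j)%N || (j.+1 < i)%N ->
  (adj i * adj j = adj j * adj i)%g.
Proof.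
move=> far; apply/permP => x; apply: ord_inj; rewrite !permM !adjE.
by do ![case: ifP]; lia.
Qed.

Lemma adj_braid i j : j = i.+1 :> nat ->
  (adj i * (adj j * adj i) = adj j * (adj i * adj j))%g.
Proof.
move=> e; apply/permP => x; apply: ord_inj; rewrite !permM !adjE e.
by do ![case: ifP]; lia.
Qed.

(** Two consecutive descents form a 321 at adjacent positions; both braid words [i j i] and [j i j]
    can then be split off one letter at a time. *)
Lemma desc_braid i j p : j = i.+1 :> nat -> desc i p -> desc j p ->
  [/\ desc j (adj i * p), desc i (adj j * (adj i * p)),
      desc i (adj j * p) & desc j (adj i * (adj j * p))]%g.
Proof.
move=> e; have ji : posl j = posr i by apply: ord_inj.
have h1 : adj i (posr j) = posr j by rewrite /adj tpermD // -val_eqE /=; lia.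
have h2 : adj j (posl i) = posl i by rewrite /adj tpermD // -val_eqE /=; lia.
have j1 : adj j (posr i) = posr j by rewrite -ji adj_posl.
have j2 : adj j (posr j) = posr i by rewrite adj_posr ji.
rewrite /desc !permM ji !(adj_posl, adj_posr, h1, h2, j1, j2) ?ji => d1 d2.
by split => //; apply: ltn_trans d2 d1.
Qed.

End Words.

(** * Matsumoto's theorem *)

Section Matsumoto.
Variables (n : nat) (A : pzRingType) (g : 'I_n.-1 -> A).
Hypothesis g_comm : forall i j : 'I_n.-1, (i.+1 < j)%N || (j.+1 < i)%N ->
  (g i * g j = g j * g i)%R.
Hypothesis g_braid : forall i j : 'I_n.-1, j = i.+1 :> nat ->
  (g i * g j * g i = g j * g i * g j)%R.

Definition gword (s : seq 'I_n.-1) : A := (\prod_(i <- s) g i)%R.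

Lemma gword_cons i s : gword (i :: s) = (g i * gword s)%R.
Proof. by rewrite /gword big_cons. Qed.

(** Induction on the length, comparing first letters. If they differ, both are descents of the
    permutation, which therefore has reduced words beginning with either side of the commutation or
    braid relation and ending in a common word; the induction hypothesis applies to the tails. *)
Lemma gword_reduced s s' :
  reduced s -> reduced s' -> pword s = pword s' -> gword s = gword s'.
Proof.
have [m] := ubnP (size s); elim: m s s' => // m IH s s' /ltnSE le_sm rs rs' e.
have es : size s = size s' by rewrite -(eqP rs) -(eqP rs') e.
case: s s' le_sm rs rs' e es => [|i u] [|j v] // /= lt_um.
(* The braid case for [j' = i'.+1], stated for arbitrary words so that it also serves with the two
   words exchanged. *)
have key i' j' p u' v' : p = pword (i' :: u') -> p = pword (j' :: v') ->
    size u' = size v' ->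
    reduced u' -> reduced v' -> (size u' < m)%N -> j' = i'.+1 :> nat ->
    desc i' p -> desc j' p -> gword (i' :: u') = gword (j' :: v').
  move=> e1 e2 es ru rv lt eij d1 d2.
  have [d3 d4 d5 d6] := desc_braid eij d1 d2.
  have eu : pword u' = (adj i' * p)%g by rewrite e1 pword_cons mul_adjK.
  have ev : pword v' = (adj j' * p)%g by rewrite e2 pword_cons mul_adjK.
  (* [q] is [p] with the longest element of the group generated by [adj i'] and [adj j'] split
     off. *)
  pose q := (adj i' * (adj j' * (adj i' * p)))%g.
  have eq' : q = (adj j' * (adj i' * (adj j' * p)))%g.
    by rewrite /q !mulgA -(mulgA (adj i') (adj j') (adj i')) adj_braid // !mulgA.
  have r1 : reduced (j' :: i' :: rword q).
    rewrite !reduced_cons rword_reduced pword_cons pword_rword.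
    by rewrite {1}/q desc_adj d4 /q mul_adjK desc_adj d3.
  have r2 : reduced (i' :: j' :: rword q).
    rewrite !reduced_cons rword_reduced pword_cons pword_rword.
    by rewrite {1}eq' desc_adj d6 eq' mul_adjK desc_adj d5.
  rewrite !gword_cons (IH u' (j' :: i' :: rword q)) //; last first.
    by rewrite !pword_cons pword_rword /q !mul_adjK.
  rewrite (IH v' (i' :: j' :: rword q)) -?es //; last first.
    by rewrite !pword_cons pword_rword eq' !mul_adjK.
  by rewrite !gword_cons !mulrA g_braid.
rewrite !reduced_cons => /andP[ru nu] /andP[rv nv] e [es].
have di : desc i (pword (i :: u)) by rewrite pword_cons desc_adj.
have dj : desc j (pword (i :: u)) by rewrite e pword_cons desc_adj.
have [eij|neij] := eqVneq i j.
  rewrite !gword_cons eij (IH u v) //.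
  by apply: (@mulgI _ (adj i)); rewrite -pword_cons e pword_cons eij.
have [e1|ne1] := eqVneq (j : nat) i.+1.
  by apply: (key _ _ (pword (i :: u))).
have [e2|ne2] := eqVneq (i : nat) j.+1.
  by symmetry; apply: (key _ _ (pword (i :: u))); rewrite -?es.
have far : (i.+1 < j)%N || (j.+1 < i)%N.
  by move: neij; rewrite -val_eqE /=; lia.
have far' : (j.+1 < i)%N || (i.+1 < j)%N by rewrite orbC.
set p := pword (i :: u) in e di dj.
have eu : pword u = (adj i * p)%g by rewrite /p pword_cons mul_adjK.
have ev : pword v = (adj j * p)%g by rewrite e pword_cons mul_adjK.
pose q := (adj j * (adj i * p))%g.
have eq' : q = (adj i * (adj j * p))%g by rewrite /q !mulgA adj_far.
have r1 : reduced (j :: rword q).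
  rewrite reduced_cons rword_reduced pword_rword /q desc_adj negbK.
  by rewrite desc_adj_far.
have r2 : reduced (i :: rword q).
  rewrite reduced_cons rword_reduced pword_rword eq' desc_adj negbK.
  by rewrite desc_adj_far.
rewrite !gword_cons (IH u (j :: rword q)) //; last first.
  by rewrite pword_cons pword_rword /q mul_adjK.
rewrite (IH v (i :: rword q)) -?es //; last first.
  by rewrite pword_cons pword_rword eq' mul_adjK.
by rewrite !gword_cons !mulrA g_comm.
Qed.

Definition gperm (p : 'S_n) := gword (rword p).

Lemma gperm_adj i p : ~~ desc i p -> (g i * gperm p)%R = gperm (adj i * p)%g.
Proof.
move=> nd; rewrite /gperm -gword_cons; apply: gword_reduced.
- by rewrite reduced_cons rword_reduced pword_rword.
- exact: rword_reduced.
- by rewrite pword_cons !pword_rword.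
Qed.

Lemma gperm_desc i p : desc i p -> gperm p = (g i * gperm (adj i * p)%g)%R.
Proof.
move=> d; rewrite gperm_adj ?mul_adjK //.
by rewrite desc_adj negbK.
Qed.

Lemma gperm1 : gperm 1%g = 1%R.
Proof.
rewrite /gperm (_ : rword 1%g = [::]) /gword ?big_nil //.
by apply: size0nil; rewrite size_rword ninv_1.
Qed.

End Matsumoto.

(** * Counting coloured permutations without a 321-pattern of colour zero *)

Section Patterns.
Variables (d n : nat).
Implicit Types (psi : {ffun 'I_n -> 'I_d}) (p : 'S_n).

Definition has_pattern psi p := [exists a, exists b, exists c,
  [&& (val a < val b)%N, (val b < val c)%N, (p b < p a)%N, (p c < p b)%N &
   [&& psi a == 0 :> nat, psi b == 0%N :> nat & psi c == 0%N :> nat]]].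

Lemma has_patternP psi p : reflect (exists a b c : 'I_n,
  [/\ (a < b < c)%N, (p c < p b < p a)%N &
   [/\ psi a = 0%N :> nat, psi b = 0%N :> nat & psi c = 0%N :> nat]])
  (has_pattern psi p).
Proof.
apply: (iffP existsP) => [[a /existsP[b /existsP[c]]]|[a [b [c]]]].
  case/and5P=> h1 h2 h3 h4 /and3P[/eqP h5 /eqP h6 /eqP h7].
  by exists a, b, c; split; [rewrite h1|rewrite h4|].
case=> /andP[h1 h2] /andP[h3 h4] [h5 h6 h7].
exists a; apply/existsP; exists b; apply/existsP; exists c.
by rewrite h1 h2 h3 h4 h5 h6 h7.
Qed.

End Patterns.

(** * Sequences avoiding 321 and ballot numbers *)

Section Avoid321.
Implicit Types (s u : seq nat) (m k a b r : nat).

Fixpoint avoids321 s : bool :=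
  if s is x :: s' then
    pairwise (fun b c => ~~ ((c < b) && (b < x))) s' && avoids321 s'
  else true.

Fixpoint incr_suffix s : nat :=
  if s is x :: s' then
    if pairwise leq s then size s else incr_suffix s'
  else 0.

(** [j] counts the entries to the right of the inserted value, because these decide whether a
    321-pattern arises. *)
Definition insert_max m u j := take (size u - j) u ++ m :: drop (size u - j) u.

(** A largest value can only play the role of 3 in a pattern, and it does so exactly when an
    inversion follows it. *)
Lemma avoids321_insert m u1 u2 : all (gtn m) (u1 ++ u2) ->
  avoids321 (u1 ++ m :: u2) = avoids321 (u1 ++ u2) && pairwise leq u2.
Proof.
elim: u1 => [|x u1 IH] /=.
  move=> lt; rewrite andbC; congr (_ && _).
  apply: (@eq_in_pairwise _ (gtn m) _ _ _ u2 lt) => b c.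
  by rewrite !unfold_in /= => bm _; rewrite bm andbT -leqNgt.
case/andP=> ltx lt; rewrite IH // andbA; congr (_ && _ && _).
rewrite !pairwise_cat pairwise_cons; move: lt; rewrite all_cat => /andP[lt1 lt2].
have -> : allrel (fun b c => ~~ ((c < b) && (b < x))) u1 (m :: u2) =
          allrel (fun b c => ~~ ((c < b) && (b < x))) u1 u2.
  rewrite allrel_consr; have -> // : all (fun b => ~~ ((m < b) && (b < x))) u1.
  by apply/allP => b /(allP lt1) /=; lia.
have -> // : all (fun c => ~~ ((c < m) && (m < x))) u2.
by apply/allP => c _; lia.
Qed.

Lemma incr_suffix_le u : incr_suffix u <= size u.
Proof. by elim: u => //= x u IH; case: ifP => // _; apply: leqW. Qed.

Lemma incr_suffixP u j : j <= size u ->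
  pairwise leq (drop (size u - j) u) = (j <= incr_suffix u).
Proof.
elim: u j => [|x u IH] j; first by rewrite leqn0 => /eqP ->.
rewrite leq_eqVlt => /orP[/eqP->|lt].
  rewrite subnn drop0 /=; case: ifP => [_|_]; first by rewrite leqnn.
  by rewrite ltnNge incr_suffix_le.
rewrite (_ : size (x :: u) - j = (size u - j).+1); last by rewrite /= in lt *; lia.
rewrite [LHS]/= IH //=; case: ifP => // /andP[_ pw].
have lt' : j <= size u by [].
by rewrite -IH // (subseq_pairwise (drop_subseq _ _) pw) ltnW.
Qed.

Lemma incr_suffix_rcons m u : all (gtn m) u ->
  incr_suffix (u ++ [:: m]) = (incr_suffix u).+1.
Proof.
elim: u => [//|x u IH] /= /andP[ltx lt].
rewrite IH // all_cat pairwise_cat /= andbT allrel1r.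
have -> : all (leq^~ m) u by apply/allP => b /(allP lt) /=; lia.
by rewrite (ltnW ltx) !andbT; case: ifP => // _; rewrite size_cat addn1.
Qed.

Lemma incr_suffix_cat m u1 u2 : all (gtn m) u2 -> pairwise leq u2 -> 0 < size u2 ->
  incr_suffix (u1 ++ m :: u2) = size u2.
Proof.
case: u2 => // y u2 /andP[/= lty _] /= /andP[ylt pw] _; elim: u1 => [|x u1 IH] /=.
  by rewrite [m <= y]leqNgt lty /= ylt pw.
rewrite IH ifF //; apply/negbTE/negP => /andP[_].
by rewrite pairwise_cat /= [m <= y]leqNgt lty /= !andbF.
Qed.

(** For [j > 0] the inserted maximum is followed by a smaller entry, so the increasing suffix begins
    just after it. *)
Lemma incr_suffix_insert m u j : all (gtn m) u -> j <= incr_suffix u ->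
  incr_suffix (insert_max m u j) = if j == 0 then (incr_suffix u).+1 else j.
Proof.
move=> lt lej; have lej' := leq_trans lej (incr_suffix_le u).
rewrite /insert_max; case: (posnP j) => [->|j_gt0].
  by rewrite subn0 take_size drop_size incr_suffix_rcons.
have sd : size (drop (size u - j) u) = j by rewrite size_drop; lia.
rewrite incr_suffix_cat ?sd ?incr_suffixP //.
by apply/allP => x /mem_drop /(allP lt).
Qed.

Fixpoint avoiders m k : seq (seq nat) :=
  match m, k with
  | _, 0 => [:: [::]]
  | 0, _.+1 => [::]
  | m'.+1, k'.+1 => avoiders m' k ++
      [seq insert_max m' u j | u <- avoiders m' k', j <- iota 0 (incr_suffix u).+1]
  end.

Lemma avoiders0 m : avoiders m 0 = [:: [::]].
Proof. by case: m. Qed.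

Lemma avoidersS m k : avoiders m.+1 k.+1 = avoiders m k.+1 ++
  [seq insert_max m u j | u <- avoiders m k, j <- iota 0 (incr_suffix u).+1].
Proof. by []. Qed.

Lemma mem_avoiders m k u : (u \in avoiders m k) =
  [&& size u == k, all (gtn m) u, uniq u & avoids321 u].
Proof.
elim: m k u => [|m IH] [|k] u.
- by rewrite inE; case: u.
- by rewrite in_nil; case: u => // x u; rewrite /= andbF.
- by rewrite avoiders0 inE; case: u.
rewrite avoidersS mem_cat IH; apply/orP/idP.
  case=> [/and4P[-> lt -> ->]|/allpairsPdep[v [j [vE jE ->]]]].
    by rewrite !andbT /=; apply/allP => x /(allP lt) /=; apply: ltnW.
  move: vE; rewrite IH => /and4P[/eqP sv lt uv av].
  move: jE; rewrite mem_iota add0n ltnS leq0n /= => lej.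
  have lej' := leq_trans lej (incr_suffix_le v).
  have mv : m \notin v by apply/negP => /(allP lt) /=; rewrite ltnn.
  have pm : perm_eq (insert_max m v j) (m :: v).
    by rewrite /insert_max -cat1s perm_catCA cat_take_drop.
  rewrite (perm_size pm) (perm_uniq pm) /= sv eqxx mv uv /=.
  rewrite (perm_all _ pm) /= ltnSn /insert_max avoids321_insert cat_take_drop //.
  rewrite av incr_suffixP // lej /= !andbT.
  by apply/allP => x /(allP lt) /=; apply: ltnW.
set E := flatten _.
case/and4P=> /eqP su lt uu av; have [mu|mu] := boolP (m \in u); last first.
  left; rewrite su eqxx uu av !andbT /=; apply/allP => x xu /=.
  have := allP lt x xu; rewrite /= ltnS leq_eqVlt => /orP[/eqP e|//].
  by rewrite -e xu in mu.
(* Deleting [m] leaves a shorter avoider; its place is recorded by the number [size u2] of entries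
   after it. *)
right; move: su lt uu av; case/splitPr: mu => u1 u2 su lt uu av.
have pm : perm_eq (u1 ++ m :: u2) (m :: u1 ++ u2) by rewrite -cat1s perm_catCA.
move: uu; rewrite (perm_uniq pm) /= => /andP[mv uv].
have lt' : all (gtn m) (u1 ++ u2).
  apply/allP => x xv /=; have := allP lt x; rewrite (perm_mem pm) inE xv orbT.
  move=> /(_ isT) /=; rewrite ltnS leq_eqVlt => /orP[/eqP e|//].
  by rewrite -e xv in mv.
move: av; rewrite avoids321_insert // => /andP[av pw].
have e1 : take (size (u1 ++ u2) - size u2) (u1 ++ u2) = u1.
  by rewrite size_cat addnK take_size_cat.
have e2 : drop (size (u1 ++ u2) - size u2) (u1 ++ u2) = u2.
  by rewrite size_cat addnK drop_size_cat.
apply/allpairsPdep; exists (u1 ++ u2), (size u2); split.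
- rewrite IH lt' uv av !andbT; move: su; rewrite (perm_size pm) /=.
  by case=> ->.
- rewrite mem_iota add0n ltnS leq0n /= -incr_suffixP ?e2 //.
  by rewrite size_cat leq_addl.
- by rewrite /insert_max e1 e2.
Qed.

Lemma uniq_avoiders m k : uniq (avoiders m k).
Proof.
elim: m k => [|m IH] [|k] //.
rewrite avoidersS cat_uniq IH andTb; apply/andP; split.
  apply/hasPn => _ /allpairsPdep[v [j [vE jE ->]]]; rewrite mem_avoiders.
  apply/negP => /and4P[_ /allP/(_ m)]; rewrite /insert_max mem_cat mem_head orbT.
  by move=> /(_ isT); rewrite /= ltnn.
have mem v j : v \in avoiders m k -> j \in iota 0 (incr_suffix v).+1 ->
    [/\ m \notin v & j <= size v].
  rewrite mem_avoiders => /and4P[_ lt _ _]; rewrite mem_iota add0n ltnS leq0n /= => lej.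
  split; last exact: leq_trans lej (incr_suffix_le v).
  by apply/negP => /(allP lt) /=; rewrite ltnn.
apply: allpairs_uniq_dep => [|v _|[v j] [v' j']]; first exact: IH.
  exact: iota_uniq.
move=> /allpairsPdep[x [y [/mem h /h{h}[h1 h2] ex]]].
move=> /allpairsPdep[x' [y' [/mem h /h{h}[h1' h2'] ex']]].
rewrite {}ex {}ex' /= => e.
(* An insertion determines its parameters: deleting [m] recovers the old list, and counting the
   entries after [m] recovers the place. *)
have rmE w i : m \notin w -> filter (predC1 m) (insert_max m w i) = w.
  move=> mw; rewrite /insert_max filter_cat /= eqxx /= -filter_cat cat_take_drop.
  by apply/all_filterP/allP => b bw /=; apply: contraNneq mw => <-.
have ixE w i : m \notin w -> i <= size w -> size w - index m (insert_max m w i) = i.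
  move=> mw le; rewrite /insert_max index_cat /= eqxx addn0 ifN.
    by rewrite size_takel ?leq_subr // subKn.
  by apply: contra mw => /mem_take.
have e' : x = x' by rewrite -(rmE x y) // e rmE.
by subst x'; rewrite -(ixE x y) // e ixE.
Qed.

(** The ballot triangle. By [count_avoiders] with [m = k] it counts the 321-avoiding permutations of
    [k] values whose increasing suffix has length at least [a]. *)
Fixpoint ballot k a : nat :=
  if k is k'.+1 then \sum_(a.-1 <= b < k) ballot k' b else (a == 0).

(** Double counting of the pairs [(x, b)] with [a <= b <= f x]. *)
Lemma sum_count_ge (T : Type) (s : seq T) (f : T -> nat) k a :
  all (fun x => f x <= k) s ->
  \sum_(x <- s) ((f x).+1 - a) = \sum_(a <= b < k.+1) count (fun x => b <= f x) s.
Proof.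
elim: s => [|x s IH] /=; first by rewrite big_nil big1_eq.
case/andP=> le all_s; rewrite big_cons IH // big_split /=; congr (_ + _).
transitivity (\sum_(a <= b < (f x).+1) 1); first by rewrite sum_nat_const_nat muln1.
have [lea|lta] := leqP a (f x).+1; last first.
  rewrite big_geq; last by apply: ltnW.
  by rewrite big_nat_cond big1 // => b /andP[/andP[ab _] _]; apply/eqP; rewrite eqb0;
    lia.
rewrite (@big_cat_nat _ _ _ (f x).+1 a k.+1) //= [X in _ = _ + X]big_nat_cond [X in _ =
  _ + X]big1 ?addn0.
  by apply: eq_big_nat => b /andP[_ lt]; rewrite -ltnS lt.
by move=> b /andP[/andP[h _] _]; apply/eqP; rewrite eqb0 -ltnNge.
Qed.

(** Pascal's rule separates the lists without the largest value from those with it; the latter are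
    counted through the suffix length before the insertion. *)
Lemma count_avoiders m k a :
  count (fun u => a <= incr_suffix u) (avoiders m k) = 'C(m, k) * ballot k a.
Proof.
elim: m k a => [|m IH] [|k] a.
- by rewrite /= leqn0 addn0 mul1n.
- by rewrite mul0n.
- by rewrite avoiders0 bin0 mul1n /= leqn0 addn0.
rewrite avoidersS count_cat IH binS mulnDl; congr (_ + _).
rewrite count_flatten -map_comp sumnE big_map.
(* Every insertion has a suffix of length at least one, so [a = 0] and [a = 1] give the same count;
   [a.-1] covers both. *)
transitivity (\sum_(u <- avoiders m k) ((incr_suffix u).+1 - a.-1)).
  rewrite !big_seq; apply: eq_bigr => u; rewrite mem_avoiders => /and4P[_ lt _ _].
  rewrite [LHS]count_map; have [->|a_gt0] := posnP a.
    by rewrite subn0 (eq_count (a2 := predT)) // count_predT size_iota.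
  (* The suffix lengths after insertion are [r.+1] for [j = 0] and [1, ..., r] for the other [j]:
     each of [1, ..., r.+1] once. *)
  set r := incr_suffix u; transitivity (count (leq a) (r.+1 :: iota 1 r)).
    rewrite [iota _ _]/= /= incr_suffix_insert //= -/r; congr (_ + _).
    apply: eq_in_count => j; rewrite mem_iota => /andP[j_gt0 lej] /=.
    by rewrite incr_suffix_insert // (gtn_eqF j_gt0).
  have iS p : iota 1 p.+1 = iota 1 p ++ [:: p.+1].
    by have := iotaD 1 p 1; rewrite addn1 add1n.
  rewrite (seq.permP (_ : perm_eq (r.+1 :: iota 1 r) (iota 1 r.+1))); last first.
    by rewrite iS -cat1s perm_catC.
  elim: (r.+1) => [|p IHp]; first by rewrite sub0n.
  rewrite iS count_cat IHp /= addn0.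
  by case: leqP; lia.
rewrite (@sum_count_ge _ _ _ k).
  by rewrite [ballot _ _]/= big_distrr /=; apply: eq_bigr => b _; rewrite IH.
by apply/allP => u; rewrite mem_avoiders => /and4P[/eqP <- _ _ _];
  apply: incr_suffix_le.
Qed.

(** The reflection formula [C(2k-a, k) - C(2k-a, k+1)], written additively to avoid truncated
    subtraction. Induction on [k], then downwards on [a], with Pascal's rule. *)
Lemma ballot_closed k a : a <= k ->
  ballot k a + 'C(k.*2 - a, k.+1) = 'C(k.*2 - a, k).
Proof.
elim: k a => [|k IH] a; first by case: a.
move=> lea; rewrite -(subKn lea).
have : k.+1 - a <= k.+1 by rewrite leq_subr.
move: (k.+1 - a) => e {a lea}; elim: e => [_|e IHe lte].
  have := IH k (leqnn k); rewrite subn0 [ballot k.+1 _]/= big_nat1.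
  have -> : (k.+1).*2 - k.+1 = k.+1 by lia.
  have -> : k.*2 - k = k by lia.
  by rewrite !binn !bin_small // !addn0.
have {IHe} := IHe (ltnW lte); set a := k.+1 - e => IHe.
have ea : k.+1 - e.+1 = a.-1 by lia.
(* For [a > 1] the sum defining [ballot k.+1 a.-1] has one more term than that for [a]; for [a = 1]
   both sums start at [0] and the two numbers coincide. *)
rewrite {}ea; case: (ltnP 1 a) => [a_gt1|a_le1].
  have -> : ballot k.+1 a.-1 = ballot k a.-2 + ballot k.+1 a.
    by rewrite [LHS]/= [ballot k.+1 a]/= big_ltn; [congr (_ + bigop _ _ _);
      congr index_iota|]; lia.
  have := IH a.-2; have -> : k.*2 - a.-2 = (k.+1).*2 - a by lia.
  have -> : (k.+1).*2 - a.-1 = ((k.+1).*2 - a).+1 by lia.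
  rewrite !binS; lia.
have e1 : a = 1 by lia.
rewrite e1 in IHe *; rewrite /= in IHe *.
move: IHe; rewrite subn0 -[(k.+1).*2]/(k.*2.+2) subn1 /= !binS.
have : 'C(k.*2.+1, k) = 'C(k.*2.+1, k.+1).
  by rewrite -bin_sub; [congr 'C(_, _)|]; lia.
rewrite !binS; lia.
Qed.

Lemma ballot_catalan k : ballot k 0 = catalan k.
Proof.
have := ballot_closed (leq0n k); rewrite subn0 => e.
have := catalanE k; have h : k.+1 * 'C(k.*2, k.+1) = k * 'C(k.*2, k).
  by rewrite mul_bin_left -addnn addnK.
nia.
Qed.

Lemma size_avoiders m k : size (avoiders m k) = 'C(m, k) * catalan k.
Proof.
rewrite -ballot_catalan -count_avoiders -[LHS]count_predT.
by apply: eq_count.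
Qed.

End Avoid321.

(** * Counting the pairs of a colouring and a permutation without pattern *)

Section CountAvoiding.
Variables (d n : nat).
Local Notation coloring := {ffun 'I_n -> 'I_d}.
Implicit Types (psi : coloring) (p : 'S_n).

Lemma avoids321_mapP (f : 'I_n -> nat) (s : seq 'I_n) :
  pairwise (fun a b : 'I_n => a < b) s ->
  reflect (exists a b c : 'I_n,
      [/\ [/\ a \in s, b \in s & c \in s], a < b < c & f c < f b < f a])
    (~~ avoids321 [seq f j | j <- s]).
Proof.
elim: s => [_|x s IH /= /andP[/allP ltx pw]].
  by constructor=> -[a [b [c [[]]]]].
rewrite negb_and; apply: (iffP orP) => [[|/(IH pw)[a [b [c [[ha hb hc] h1 h2]]]]]|].
- rewrite pairwise_map => h.
  have [b [c [bs cs ltbc hbc]]] : exists b c : 'I_n,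
      [/\ b \in s, c \in s, b < c & f c < f b < f x].
    move: h; elim: s pw {IH ltx} => //= y s IHs /andP[/allP lty pw].
    rewrite negb_and => /orP[/allPn[c cs]|/(IHs pw)[b [c [bs cs h1 h2]]]].
      rewrite negbK => h; exists y, c; rewrite mem_head inE cs orbT.
      by split => //; apply: lty.
    by exists b, c; rewrite !inE bs cs !orbT.
  exists x, b, c; rewrite mem_head !inE bs cs !orbT; split=> //.
  by rewrite ltbc ltx.
- by exists a, b, c; rewrite !inE ha hb hc !orbT.
case=> [a [b [c [[]]]]]; rewrite !inE => ha hb hc /andP[h1 h2] h3.
have lt_xs y : (y == x) || (y \in s) -> x <= y.
  by case/orP => [/eqP ->//|/ltx/ltnW].
have bs : b \in s.
  by case/orP: hb => // /eqP e; move: (lt_xs _ ha); rewrite -e leqNgt h1.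
have cs : c \in s.
  by case/orP: hc => // /eqP e; have := lt_xs _ ha; have := ltn_trans h1 h2;
    rewrite e; lia.
case/orP: ha => [/eqP e|as_]; last by right; apply/IH => //; exists a, b, c; rewrite h1.
left; rewrite pairwise_map; apply/negP => pws.
have := pws; move=> {pws}; elim: s bs cs pw {IH ltx lt_xs hb hc} => //= y s IHs.
rewrite !inE => hb hc /andP[/allP lty pw] /andP[/allP hy pws].
case/orP: hb => [/eqP eb|bs]; case/orP: hc => [/eqP ec|cs].
- by move: h2; rewrite eb ec ltnn.
- by have := hy _ cs; rewrite /= -eb -e h3.
- by move: h2; have := lty _ bs; rewrite ec; lia.
- exact: IHs.
Qed.

Definition zeros psi : {set 'I_n} := [set j | psi j == 0 :> nat].

Definition zero_word psi p : seq nat := [seq val (p j) | j <- enum (zeros psi)].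

Lemma has_patternE psi p : has_pattern psi p = ~~ avoids321 (zero_word psi p).
Proof.
(* [enum] lists the positions of colour zero from left to right, so patterns at these positions are
   patterns of the list of values. *)
have pw : pairwise (fun a b : 'I_n => a < b) (enum (zeros psi)).
  rewrite {1}/enum_mem; apply: pairwise_filter; rewrite -enumT.
  have := iota_ltn_sorted 0 n; rewrite (sorted_pairwise ltn_trans) -val_enum_ord.
  by rewrite pairwise_map.
apply/has_patternP/(avoids321_mapP (fun j => val (p j)) pw) => -[a [b [c]]].
  case=> h1 h2 [/eqP ha /eqP hb /eqP hc]; exists a, b, c.
  by rewrite !mem_enum !inE.
rewrite !mem_enum !inE => -[[/eqP ha /eqP hb /eqP hc] h1 h2].
by exists a, b, c.
Qed.

Lemma size_zero_word psi p : size (zero_word psi p) = #|zeros psi|.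
Proof. by rewrite size_map -cardE. Qed.

Lemma perm_extension (s : seq 'I_n) (u : seq nat) :
  uniq s -> uniq u -> size s = size u -> all (gtn n) u ->
  exists p : 'S_n, [seq val (p j) | j <- s] = u.
Proof.
move=> us uu su lt.
(* Both lists are completed by the missing entries to lists of length [n]; the permutation matches
   them entry by entry. *)
pose e := s ++ [seq x <- enum 'I_n | x \notin s].
pose f := u ++ [seq x <- iota 0 n | x \notin u].
have ue : uniq e.
  rewrite cat_uniq us filter_uniq ?enum_uniq // andbT; apply/hasPn => x.
  by rewrite mem_filter => /andP[].
have uf : uniq f.
  rewrite cat_uniq uu filter_uniq ?iota_uniq // andbT; apply/hasPn => x.
  by rewrite mem_filter => /andP[].
have me x : x \in e.
  by rewrite mem_cat mem_filter mem_enum andbT; case: (x \in s).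
have sf : size f = n.
  rewrite -[RHS](size_iota 0); apply: perm_size; apply: uniq_perm => //.
    exact: iota_uniq.
  move=> x; rewrite mem_cat mem_filter mem_iota /= add0n.
  by have [/(allP lt)/= ->|] := boolP (x \in u).
have se : size e = n.
  rewrite -[RHS](size_enum_ord n); apply: perm_size; apply: uniq_perm => //.
    exact: enum_uniq.
  by move=> x; rewrite me mem_enum.
have sfe : size f = size e by rewrite sf se.
have ltf (x : 'I_n) : nth 0 f (index x e) < n.
  have : nth 0 f (index x e) \in f by apply: mem_nth; rewrite sfe index_mem me.
  rewrite mem_cat mem_filter mem_iota add0n => /orP[/(allP lt)//|/and3P[]//].
pose g (x : 'I_n) : 'I_n := Ordinal (ltf x).
have g_inj : injective g.
  move=> x y /(congr1 val) /= /eqP; rewrite nth_uniq ?sfe ?index_mem ?me //.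
  move/eqP => h; by rewrite -(nth_index x (me x)) h nth_index.
exists (perm g_inj); apply: (@eq_from_nth _ 0); rewrite size_map // => i lti.
have x0 : 'I_n by case: (s) lti.
rewrite (nth_map x0) // permE /= /e index_cat mem_nth // index_uniq //.
by rewrite /f nth_cat -su lti.
Qed.

(** One such permutation exists by [perm_extension]; the others differ from it by a permutation of
    the positions of nonzero colour. *)
Lemma card_zero_word psi u :
  uniq u -> size u = #|zeros psi| -> all (gtn n) u ->
  #|[set p | zero_word psi p == u]| = (n - #|zeros psi|)`!.
Proof.
move=> uu su lt.
have [||||p0 p0E] := @perm_extension (enum (zeros psi)) u;
  rewrite ?enum_uniq // -?cardE //.
have -> : [set p | zero_word psi p == u] =
    [set (s * p0)%g | s : 'S_n in perm_on (~: zeros psi)].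
  apply/setP => p; rewrite inE; apply/eqP/imsetP => [h|[s /subsetP so ->]].
    exists (p * p0^-1)%g; last by rewrite -mulgA mulVg mulg1.
    apply/subsetP => j; rewrite !inE permM; apply: contra => zj.
    have/eq_in_map hj : zero_word psi p = zero_word psi p0 by rewrite h -p0E.
    by rewrite (val_inj (hj j _)) ?permK // mem_enum inE.
  rewrite -p0E; apply/eq_in_map => j; rewrite mem_enum permM => zj.
  have [e|ne] := eqVneq (s j) j; first by rewrite e.
  have : j \in ~: zeros psi by apply: so; rewrite !inE.
  by rewrite in_setC zj.
rewrite card_imset; last exact: mulIg.
by rewrite card_perm cardsCs setCK card_ord.
Qed.

Lemma card_avoiding psi : #|[set p | ~~ has_pattern psi p]| =
  'C(n, #|zeros psi|) * catalan #|zeros psi| * (n - #|zeros psi|)`!.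
Proof.
set k := #|zeros psi|.
rewrite -sum1_card (eq_bigl (fun p => zero_word psi p \in avoiders n k)); last first.
  move=> p; rewrite inE has_patternE negbK mem_avoiders size_zero_word eqxx /=.
  have -> : all (gtn n) (zero_word psi p) by apply/allP => _ /mapP[j _ ->] /=.
  by rewrite map_inj_uniq ?enum_uniq // => a b /val_inj /perm_inj.
rewrite (eq_bigr (fun p => \sum_(u <- avoiders n k) (zero_word psi p == u)));
  last first.
  move=> p pE; rewrite (bigD1_seq _ pE (uniq_avoiders n k)) /= eqxx big1 // => u.
  by rewrite eq_sym => /negPf ->.
rewrite exchange_big /=.
rewrite big_seq (eq_bigr (fun=> (n - k)`!)).
  by rewrite -big_seq big_const_seq count_predT iter_addn_0 size_avoiders mulnC.
move=> u uE; have := uE; rewrite mem_avoiders => /and4P[/eqP su lt uu _].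
rewrite -(card_zero_word uu su lt) -sum1_card [RHS]big_mkcond [LHS]big_mkcond.
apply: eq_bigr => p _; rewrite inE; case: eqP => [->|_]; first by rewrite uE.
by case: ifP.
Qed.

Lemma card_zeros (Z : {set 'I_n}) :
  0 < d -> #|[set psi | zeros psi == Z]| = (d - 1) ^ (n - #|Z|).
Proof.
move=> d_gt0; pose z0 := Ordinal d_gt0.
pose F (j : 'I_n) : {pred 'I_d} := if j \in Z then pred1 z0 else predC1 z0.
have -> : #|[set psi | zeros psi == Z]| = #|family F|.
  apply: eq_card => psi; rewrite inE; apply/eqP/familyP => [ez j|h].
    by rewrite /F -ez inE; case: ifP => h; rewrite !inE -val_eqE /= ?h.
  apply/setP => j; rewrite inE; have := h j; rewrite /F.
  by case: ifP => _; rewrite !inE -val_eqE /= => // /negPf.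
rewrite card_family foldrE big_map big_enum /=.
rewrite (eq_bigr (fun j => if j \in ~: Z then d - 1 else 1)); last first.
  move=> j _; rewrite /F in_setC; case: (j \in Z); first by rewrite card1.
  by rewrite cardC1 card_ord subn1.
by rewrite -big_mkcond prod_nat_const cardsCs setCK card_ord.
Qed.

(** The colourings are sorted by their zero set and then by its size [k]. One factor ['C(n, k)]
    chooses the zero set, the other, from [card_avoiding], the values of [p] on it. *)
Lemma card_avoiding_pairs : 0 < d ->
  #|[set x : coloring * 'S_n | ~~ has_pattern x.1 x.2]| =
  \sum_(0 <= k < n.+1) 'C(n, k) ^ 2 * catalan k * (d - 1) ^ (n - k) * (n - k)`!.
Proof.
move=> d_gt0; rewrite -sum1_card.
rewrite (eq_bigl (fun x : coloring * 'S_n => xpredT x.1 && ~~ has_pattern x.1 x.2));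
  last first.
  by move=> x; rewrite inE.
rewrite -(pair_big_dep xpredT (fun psi p => ~~ has_pattern psi p) (fun _ _ => 1)) /=.
rewrite (eq_bigr (fun psi => 'C(n, #|zeros psi|) * catalan #|zeros psi| * (n - #|zeros
  psi|)`!)); last first.
  by move=> psi _; rewrite -card_avoiding -sum1_card; apply: eq_bigl => p; rewrite inE.
rewrite (partition_big zeros xpredT) //=.
rewrite (eq_bigr (fun Z : {set 'I_n} => 'C(n, #|Z|) * catalan #|Z| * (n - #|Z|)`! * (d
  - 1) ^ (n - #|Z|))); last first.
  move=> Z _; rewrite (eq_bigr (fun=> 'C(n, #|Z|) * catalan #|Z| * (n - #|Z|)`!));
    last first.
    by move=> psi /eqP ->.
  by rewrite sum_nat_const -card_zeros // cardsE mulnC.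
have le_n (Z : {set 'I_n}) : #|Z| < n.+1 by rewrite ltnS -[n in _ <= n]card_ord
  max_card.
rewrite (partition_big (fun Z : {set 'I_n} => Ordinal (le_n Z)) xpredT) //= big_mkord.
apply: eq_bigr => k _.
rewrite (eq_bigr (fun=> 'C(n, k) * catalan k * (n - k)`! * (d - 1) ^ (n - k)));
  last first.
  by move=> Z /eqP <-.
rewrite sum_nat_const.
have -> : #|[pred Z : {set 'I_n} | Ordinal (le_n Z) == k]| = 'C(n, k).
  rewrite -[n in 'C(n, _)]card_ord -[RHS]card_draws -cardsE; apply: eq_card => Z.
  by rewrite !inE -val_eqE.
by rewrite -mulnn -!mulnA; congr (_ * (_ * (_ * _))); rewrite mulnC.
Qed.
End CountAvoiding.

Local Open Scope ring_scope.
Local Open Scope quotient_scope.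

(** * Straightening *)

Section CommutingProducts.
Variables (A : pzRingType) (I : eqType) (F : I -> A).
Hypothesis F_comm : forall i j, F i * F j = F j * F i.

Lemma prod_comm_rem x s : x \in s ->
  \prod_(i <- s) F i = F x * \prod_(i <- rem x s) F i.
Proof.
elim: s => // y s IH; rewrite inE /= big_cons.
have [->//|ne] := eqVneq x y.
by move=> /= /IH ->; rewrite big_cons !mulrA F_comm.
Qed.

Lemma prod_comm_perm s s' : perm_eq s s' ->
  \prod_(i <- s) F i = \prod_(i <- s') F i.
Proof.
elim: s s' => [|x s IH] s' h.
  by move: h; rewrite perm_sym => /perm_nilP ->.
have xs' : x \in s' by rewrite -(perm_mem h) mem_head.
rewrite big_cons (prod_comm_rem xs'); congr (_ * _); apply: IH.
by rewrite -(perm_cons x); apply: perm_trans h _; apply: perm_to_rem.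
Qed.

End CommutingProducts.

(** * Linear spans in an algebra *)

Section Span.
Variables (R : comNzRingType) (A : alg R).

Inductive linspan (X : A -> Prop) : A -> Prop :=
| SpanGen x : X x -> linspan X x
| Span0 : linspan X 0
| SpanD x y : linspan X x -> linspan X y -> linspan X (x + y)
| SpanZ c x : linspan X x -> linspan X (alg_cst A c * x).

Lemma span_bind (X Y : A -> Prop) x :
  (forall y, X y -> linspan Y y) -> linspan X x -> linspan Y x.
Proof.
move=> h; elim=> [y /h//||y z _ hy _ hz|c y _ hy];
  by [exact: Span0|exact: SpanD|exact: SpanZ].
Qed.

Lemma span_mul (X Y : A -> Prop) a x :
  (forall y, X y -> linspan Y (a * y)) -> linspan X x -> linspan Y (a * x).
Proof.
move=> h; elim=> [y /h//||y z _ hy _ hz|c y _ hy].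
- by rewrite mulr0; apply: Span0.
- by rewrite mulrDr; apply: SpanD.
- by rewrite mulrA -alg_central -mulrA; apply: SpanZ.
Qed.

Lemma spanN X x : linspan X x -> linspan X (- x).
Proof. by move=> h; rewrite -mulN1r -(rmorphN1 (alg_cst A)); apply: SpanZ. Qed.

Lemma span_sum X (I : Type) (r : seq I) (P : pred I) (F : I -> A) :
  (forall i, P i -> linspan X (F i)) -> linspan X (\sum_(i <- r | P i) F i).
Proof.
move=> h; elim/big_rec: _ => [|i x Pi]; first exact: Span0.
by apply: SpanD; apply: h.
Qed.

End Span.

(** * Spanning by the pairs without pattern *)

Section Spanning.
Variables (R : comNzRingType) (A : alg R) (d n : nat).
Variables (g : 'I_n.-1 -> A) (t : 'I_n -> A) (q qi dv w wb : R).
Implicit Types (i : 'I_n.-1) (j : 'I_n) (p : 'S_n).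
Local Notation cst := (alg_cst A).
Local Notation coloring := {ffun 'I_n -> 'I_d}.
Implicit Types psi : coloring.

Definition avg_e i : A :=
  cst dv * \sum_(s < d) t (posl i) ^+ s * (t (posr i) ^+ d.-1) ^+ s.
Definition avg_T (j : 'I_n) : A := cst dv * \sum_(s < d) t j ^+ s.
Definition qsym (i j : 'I_n.-1) : A :=
  1 + g i + g j + g i * g j + g j * g i + g i * g j * g i.

Hypothesis d_gt0 : (0 < d)%N.
Hypothesis g_comm : forall i i', (i.+1 < i')%N || (i'.+1 < i)%N ->
  g i * g i' = g i' * g i.
Hypothesis g_braid : forall i i', i' = i.+1 :> nat ->
  g i * g i' * g i = g i' * g i * g i'.
Hypothesis t_comm : forall j k : 'I_n, t j * t k = t k * t j.
Hypothesis t_g : forall i (j : 'I_n), t j * g i = g i * t (adj i j).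
Hypothesis t_d : forall j : 'I_n, t j ^+ d = 1.
Hypothesis g_quad : forall i, g i ^+ 2 = cst q + cst (q - 1) * avg_e i * g i.
Hypothesis qsym_kill : forall (j : 'I_n) i1 i2,
  j = 0%N :> nat -> i1 = 0%N :> nat -> i2 = 1%N :> nat ->
  avg_T j * avg_e i1 * avg_e i2 * qsym i1 i2 = 0.
Hypothesis q_inv : q * qi = 1.
Hypothesis w_inv : w * wb = 1.
Hypothesis w_d : w ^+ d = 1.
Hypothesis w_orth : forall s, (s < d)%N ->
  dv * \sum_(c < d) (wb ^+ c) ^+ s = (s == 0%N)%:R.

Lemma cst_comm a x : GRing.comm (cst a) x.
Proof. exact: alg_central. Qed.

Lemma wb_d : wb ^+ d = 1.
Proof. by rewrite -[LHS]mul1r -{1}w_d -exprMn w_inv expr1n. Qed.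

Lemma dv_d : dv * d%:R = 1.
Proof.
have := w_orth d_gt0; under eq_bigr do rewrite expr0.
by rewrite sumr_const card_ord.
Qed.

(** The spectral projector of [t j] for the eigenvalue [w ^+ c]. *)
Definition eproj (j : 'I_n) (c : nat) : A :=
  cst dv * \sum_(s < d) (cst (wb ^+ c) * t j) ^+ s.

Definition ecol psi : A := \prod_j eproj j (psi j).

Lemma t_eproj (j k : 'I_n) c : t k * eproj j c = eproj j c * t k.
Proof.
apply: commrM; first exact/commr_sym/cst_comm.
apply: commr_sum => s _; apply: commrX; apply: commrM => //.
exact/commr_sym/cst_comm.
Qed.

Lemma eproj_comm (j k : 'I_n) c e : eproj j c * eproj k e = eproj k e * eproj j c.
Proof.
apply/commr_sym/commrM; first exact/commr_sym/cst_comm.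
apply: commr_sum => s _; apply: commrX; apply: commrM.
  exact/commr_sym/cst_comm.
exact/commr_sym/t_eproj.
Qed.

Lemma eproj_t (j : 'I_n) c : eproj j c * t j = cst (w ^+ c) * eproj j c.
Proof.
(* Since [x ^+ d = 1], the sum of the powers of [x] absorbs a factor [x]; this is the eigenvalue
   equation. *)
pose x := cst (wb ^+ c) * t j.
have xd : x ^+ d = 1.
  rewrite exprMn_comm; last exact: cst_comm.
  by rewrite t_d mulr1 -(rmorphXn cst) exprAC wb_d expr1n rmorph1.
have xs : (\sum_(s < d) x ^+ s) * x = \sum_(s < d) x ^+ s.
  case: (d) d_gt0 xd => // d' _ xd.
  rewrite mulr_suml big_ord_recr big_ord_recl /= -exprSr xd addrC expr0.
  by congr (_ + _); apply: eq_bigr => s _; rewrite -exprSr.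
have -> : t j = cst (w ^+ c) * x.
  by rewrite mulrA -(rmorphM cst) -exprMn w_inv expr1n rmorph1 mul1r.
by rewrite /eproj -/x mulrA -cst_comm -!mulrA xs.
Qed.

(** Summing over [c] first, the orthogonality of characters leaves only the term [s = 0]. *)
Lemma eproj_sum (j : 'I_n) : \sum_(c < d) eproj j c = 1.
Proof.
rewrite -mulr_sumr exchange_big /= mulr_sumr.
transitivity (\sum_(s < d) cst ((val s == 0%N)%:R) * t j ^+ s).
  apply: eq_bigr => s _; rewrite -w_orth ?ltn_ord // (rmorphM cst) -mulrA;
    congr (_ * _).
  rewrite (rmorph_sum cst) mulr_suml; apply: eq_bigr => c _.
  by rewrite exprMn_comm; [rewrite -[in LHS](rmorphXn cst)|apply: cst_comm].
case: (d) d_gt0 => // d' _; rewrite big_ord_recl /= rmorph1 mul1r expr0 big1 ?addr0 //.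
by move=> s _; rewrite rmorph0 mul0r.
Qed.

Lemma ecol_sum : \sum_psi ecol psi = 1.
Proof.
rewrite /ecol -(bigA_distr_bigA (fun j (c : 'I_d) => eproj j c)).
by rewrite big1 // => j _; rewrite eproj_sum.
Qed.

Lemma ecol_t psi (j : 'I_n) : ecol psi * t j = cst (w ^+ psi j) * ecol psi.
Proof.
have pc a b : eproj a (psi a) * eproj b (psi b) = eproj b (psi b) * eproj a (psi a).
  exact: eproj_comm.
rewrite /ecol (prod_comm_rem pc (mem_index_enum j)).
set r := rem j _; have tr : t j * \prod_(k <- r) eproj k (psi k) =
                            \prod_(k <- r) eproj k (psi k) * t j.
  by apply: commr_prod => k _; apply: t_eproj.
by rewrite -mulrA -tr mulrA eproj_t -mulrA.
Qed.

Definition ecol_adj i psi : coloring := [ffun j => psi (adj i j)].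

(** [g i] intertwines [t j] with [t (adj i j)] and so permutes the projectors; as these commute,
    their product can be reindexed by [adj i]. *)
Lemma g_ecol i psi : g i * ecol psi = ecol (ecol_adj i psi) * g i.
Proof.
have eg j c : eproj j c * g i = g i * eproj (adj i j) c.
  rewrite /eproj [RHS]mulrA -(cst_comm dv (g i)) -!mulrA; congr (_ * _);
    rewrite mulr_suml mulr_sumr.
  set x := cst _ * t j; set x' := cst _ * t _.
  have xg : x * g i = g i * x' by rewrite /x -mulrA t_g mulrA cst_comm -mulrA.
  apply: eq_bigr => s _; elim: (s : nat) => [|k IH];
    first by rewrite !expr0 mulr1 mul1r.
  by rewrite exprS -mulrA IH mulrA xg -mulrA -exprS.
have -> : ecol (ecol_adj i psi) * g i = g i * \prod_j eproj (adj i j) (psi (adj i j)).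
  rewrite /ecol; elim: (index_enum _) => [|j s IH].
    by rewrite !big_nil mulr1 mul1r.
  by rewrite !big_cons -mulrA IH mulrA eg ffunE -mulrA.
congr (_ * _); rewrite -(big_map (adj i) xpredT (fun j => eproj j (psi j))).
apply: prod_comm_perm; first by move=> a b; apply: eproj_comm.
apply: uniq_perm; rewrite ?index_enum_uniq ?(map_inj_uniq (@perm_inj _ (adj i)))
  ?index_enum_uniq //.
move=> x; rewrite mem_index_enum; symmetry; apply/mapP.
by exists (adj i x); rewrite ?mem_index_enum // /adj tpermK.
Qed.

Lemma ecol_adjK i psi : ecol_adj i (ecol_adj i psi) = psi.
Proof. by apply/ffunP => j; rewrite !ffunE adjKl. Qed.

Lemma ecol_g i psi : ecol psi * g i = g i * ecol (ecol_adj i psi).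
Proof. by rewrite g_ecol ecol_adjK. Qed.

Lemma ecol_tX psi (j : 'I_n) s : ecol psi * t j ^+ s = cst (w ^+ (psi j * s)) * ecol
  psi.
Proof.
elim: s => [|s IH]; first by rewrite muln0 !expr0 mulr1 rmorph1 mul1r.
by rewrite exprSr mulrA IH -mulrA ecol_t mulrA -(rmorphM cst) -exprD mulnSr.
Qed.

(** Each [t j] is a scalar on [ecol psi], so [avg_e i] becomes the average of the powers of the
    quotient of two eigenvalues; the exponent [d.-1] stands for the inverse. *)
Lemma ecol_e psi i : exists c,
  ecol psi * avg_e i = cst c * ecol psi /\ (psi (posl i) = psi (posr i) -> c = 1).
Proof.
exists (dv * \sum_(s < d) w ^+ (psi (posl i) * s + psi (posr i) * (d.-1 * s))).
split.
  rewrite /avg_e mulrA -cst_comm -mulrA (rmorphM cst) -mulrA; congr (_ * _).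
  rewrite (rmorph_sum cst) mulr_sumr mulr_suml; apply: eq_bigr => s _.
  by rewrite mulrA ecol_tX -exprM -mulrA ecol_tX mulrA -(rmorphM cst) -exprD.
move=> ->; rewrite (eq_bigr (fun=> 1)) ?sumr_const ?card_ord ?dv_d //.
move=> s _; rewrite -mulnDr (_ : (s + d.-1 * s = d * s)%N);
  last by rewrite -mulSn prednK.
by rewrite mulnCA exprM w_d expr1n.
Qed.

Lemma ecol_T psi (j : 'I_n) : psi j = 0%N :> nat -> ecol psi * avg_T j = ecol psi.
Proof.
move=> z; rewrite /avg_T mulrA -cst_comm -mulrA mulr_sumr.
rewrite (eq_bigr (fun=> ecol psi)).
  by rewrite sumr_const card_ord -mulr_natl mulrA -(rmorph_nat cst) -(rmorphM cst) dv_d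
    rmorph1 mul1r.
by move=> s _; rewrite ecol_tX z mul0n expr0 rmorph1 mul1r.
Qed.

(* On [x * ecol psi], the quadratic relation shows that [g i] is invertible
   because [q] is. *)
Lemma g_cancel i x : x * g i = 0 -> x = 0.
Proof.
move=> h; rewrite -[x]mulr1 -ecol_sum mulr_sumr big1 // => psi _.
set y := x * ecol psi; have h1 : y * g i = 0 by rewrite -mulrA ecol_g mulrA h mul0r.
have [c [ec _]] := ecol_e psi i.
have ey : y * avg_e i = cst c * y by rewrite -mulrA ec mulrA -cst_comm -mulrA.
have : y * g i ^+ 2 = 0 by rewrite expr2 mulrA h1 mul0r.
have ez : y * (cst (q - 1) * avg_e i * g i) = 0.
  by rewrite -mulrA mulrA -(cst_comm _ y) -mulrA (mulrA y) ey -mulrA h1 !mulr0.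
rewrite g_quad mulrDr ez addr0 -cst_comm => h2.
by rewrite -[LHS]mul1r -(rmorph1 cst) -q_inv mulrC (rmorphM cst) -mulrA h2 mulr0.
Qed.

(** Passing through [c = g i * g j * g k] lowers an index by one: the braid relations give
    [g j * c = c * g i] and [g k * c = c * g j]. *)
Lemma qsym_shift (i j k : 'I_n.-1) : j = i.+1 :> nat -> k = j.+1 :> nat ->
  qsym j k * (g i * g j * g k) = g i * g j * g k * qsym i j.
Proof.
move=> eij ejk; set c := g i * g j * g k.
have ik : g i * g k = g k * g i by apply: g_comm; rewrite ejk eij; lia.
have e1 : g j * c = c * g i.
  by rewrite /c !mulrA -(g_braid eij) -!mulrA -ik.
have e2 : g k * c = c * g j.
  by rewrite /c !mulrA -ik -!mulrA; congr (_ * _); rewrite !mulrA -(g_braid ejk).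
have e3 : g j * (g k * c) = c * (g i * g j) by rewrite e2 mulrA e1 mulrA.
have e4 : g k * (g j * c) = c * (g j * g i) by rewrite e1 mulrA e2 mulrA.
have e5 : g j * (g k * (g j * c)) = c * (g i * g j * g i).
  by rewrite e4 mulrA e1 !mulrA.
by rewrite /qsym !mulrDl !mulrDr mul1r mulr1 -!mulrA e5 e4 e3 e2 e1 !mulrA.
Qed.

(** At the first three positions [ecol psi] absorbs the idempotents of the defining relation.
    Elsewhere, right multiplication by three generators moves the symmetrizer one place to the left,
    and [g_cancel] removes the generators again. *)
Lemma ecol_qsym psi (i j : 'I_n.-1) : j = i.+1 :> nat ->
  psi (posl i) = 0%N :> nat -> psi (posr i) = 0%N :> nat ->
  psi (posr j) = 0%N :> nat -> ecol psi * qsym i j = 0.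
Proof.
move: {2}(nat_of_ord i) (erefl (nat_of_ord i)) => m;
  elim: m i j psi => [|m IH] i j psi im eij z1 z2 z3.
  have ji : posl j = posr i by apply: ord_inj.
  have ord2 (a b : 'I_n) : psi a = 0%N :> nat -> psi b = 0%N :> nat -> psi a = psi b.
    by move=> ha hb; apply: ord_inj; rewrite ha hb.
  have [c1 [ec1 h1]] := ecol_e psi i; have [c2 [ec2 h2]] := ecol_e psi j.
  move: ec1 ec2; rewrite h1 ?h2 ?ji; try exact: ord2.
  rewrite rmorph1 mul1r => e1 e2.
  have h : ecol psi = ecol psi * avg_T (posl i) * avg_e i * avg_e j.
    by rewrite ecol_T // e1 e2.
  by rewrite h -3!(mulrA (ecol psi)) qsym_kill ?mulr0 //= eij im.
have lt_m : (m < n.-1)%N by rewrite -ltnS -im ltnW // ltnS ltn_ord.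
pose i0 := Ordinal lt_m; have ei0 : i = i0.+1 :> nat by rewrite im.
apply: (@g_cancel i0); apply: (@g_cancel i); apply: (@g_cancel j).
rewrite -2!(mulrA (ecol psi * qsym i j)) -mulrA qsym_shift //.
rewrite mulrA 2!(mulrA (ecol psi)) ecol_g -(mulrA (g i0)) ecol_g.
rewrite -2!(mulrA (g i0)) -2!(mulrA (g i)) ecol_g -(mulrA (g j)) IH ?mulr0 //;
  rewrite !ffunE; [rewrite -z1|rewrite -z2|rewrite -z3]; congr (nat_of_ord (psi _));
  apply: ord_inj; rewrite !adjE /=; do ![case: ifP]; lia.
Qed.

Definition gbasis psi p : A := ecol psi * gperm g p.

Definition shorter k (x : A) := exists psi p, (ninv p < k)%N /\ x = gbasis psi p.
Definition avoiding (x : A) := exists psi p, ~~ has_pattern psi p /\ x = gbasis psi p.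

(** At a descent the quadratic relation turns [g i * gperm g p] into a multiple of
    [gperm g (adj i * p)] and a term with [avg_e i], which is a scalar next to [ecol psi']. *)
Lemma g_gbasis i psi p : linspan (shorter (ninv p).+2) (g i * gbasis psi p).
Proof.
rewrite /gbasis mulrA g_ecol -mulrA; set psi' := ecol_adj i psi.
have [di|ndi] := boolP (desc i p); last first.
  rewrite (gperm_adj g_comm g_braid ndi); apply: SpanGen.
  by exists psi', (adj i * p)%g; rewrite ninv_adj.
have [c [ec _]] := ecol_e psi' i.
have e : ecol psi' * (g i * gperm g p) =
    cst q * gbasis psi' (adj i * p)%g + cst ((q - 1) * c) * gbasis psi' p.
  have e1 : g i * gperm g p =
      cst q * gperm g (adj i * p)%g + cst (q - 1) * (avg_e i * gperm g p).
    rewrite (gperm_desc g_comm g_braid di) (mulrA (g i)) -expr2 g_quad mulrDl.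
    by rewrite -(mulrA (cst (q - 1) * _)) -[X in _ + X]mulrA.
  have pull a x : ecol psi' * (cst a * x) = cst a * (ecol psi' * x).
    by rewrite mulrA -cst_comm -mulrA.
  rewrite e1 mulrDr !pull (mulrA (ecol psi')) ec -(mulrA (cst c)).
  by rewrite [in RHS](rmorphM cst) -[in RHS](mulrA (cst (q - 1))).
rewrite e; apply: SpanD; apply: SpanZ; apply: SpanGen.
  by exists psi', (adj i * p)%g; split => //; rewrite (ninv_desc di); lia.
by exists psi', p; split => //; lia.
Qed.

Lemma g_shorter i k x : linspan (shorter k) x -> linspan (shorter k.+1) (g i * x).
Proof.
apply: span_mul => _ [psi [p [lt ->]]]; apply: span_bind (g_gbasis i psi p).
by move=> _ [psi' [p' [lt' ->]]]; apply: SpanGen; exists psi', p'; split => //; lia.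
Qed.

Lemma ecol_gg (i j : 'I_n.-1) psi p :
  linspan (shorter (ninv p).+3) (ecol psi * (g i * (g j * gperm g p))).
Proof.
rewrite mulrA ecol_g -mulrA; apply: g_shorter.
rewrite mulrA ecol_g -mulrA; apply: g_shorter.
by apply: SpanGen; exists (ecol_adj j (ecol_adj i psi)), p.
Qed.

Lemma ecol_g_shorter i psi p :
  linspan (shorter (ninv p).+3) (ecol psi * (g i * gperm g p)).
Proof.
rewrite mulrA ecol_g -mulrA; apply: g_shorter.
by apply: SpanGen; exists (ecol_adj i psi), p; split => //; lia.
Qed.

(** There is a descent between the first two and one between the last two positions of a pattern.
    Splitting off a descent keeps the order of the three positions unless it exchanges two of them;
    if both descents do so, the positions are consecutive. *)
Lemma pattern_reduces psi p : has_pattern psi p ->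
  (exists2 i, desc i p & has_pattern (ecol_adj i psi) (adj i * p)%g) \/
  (exists i j : 'I_n.-1, [/\ j = i.+1 :> nat, desc i p, desc j p &
    [/\ psi (posl i) = 0%N :> nat, psi (posr i) = 0%N :> nat &
        psi (posr j) = 0%N :> nat]]).
Proof.
case/has_patternP=> a [b [c [/andP[ab bc] /andP[cb ba] [za zb zc]]]].
have keep i : desc i p -> (a, b) != (posl i, posr i) ->
    (b, c) != (posl i, posr i) -> has_pattern (ecol_adj i psi) (adj i * p)%g.
  move=> di n1 n2; apply/has_patternP; exists (adj i a), (adj i b), (adj i c).
  by rewrite !permM !ffunE !adjKl !adj_lt // cb ba.
have [i [ai ib di]] := desc_between ab ba.
have [j [bj jc dj]] := desc_between bc cb.
have [ei|ni] := eqVneq (a, b) (posl i, posr i); last first.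
  left; exists i => //; apply: keep => //.
  by apply/eqP => -[eb _]; move: ib; rewrite eb /=; lia.
have [ej|nj] := eqVneq (b, c) (posl j, posr j); last first.
  left; exists j => //; apply: keep => //.
  by apply/eqP => -[_ eb]; move: bj; rewrite eb /=; lia.
case: ei ej => ea eb [eb' ec]; right; exists i, j.
rewrite -ea -eb -ec; split => //.
by have /(congr1 (@nat_of_ord n)) := eb; rewrite eb'.
Qed.

(** In the first case of [pattern_reduces], putting the factor [g i] back after the induction costs
    one unit of length. In the second, [gperm g p] is the longest term of [qsym i j * gperm g r],
    which [ecol psi] kills. *)
Lemma gbasis_pattern psi p :
  has_pattern psi p -> linspan (shorter (ninv p)) (gbasis psi p).
Proof.
have [m] := ubnP (ninv p); elim: m psi p => // m IH psi p /ltnSE le_pm.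
case/pattern_reduces => [[i di hp]|[i [j [eij di dj [z1 z2 z3]]]]].
  rewrite /gbasis (gperm_desc g_comm g_braid di) mulrA ecol_g -mulrA (ninv_desc di).
  by apply: g_shorter; apply: IH => //; rewrite -(ninv_desc di).
have [d1 d2 _ _] := desc_braid eij di dj.
pose r := (adj i * (adj j * (adj i * p)))%g.
have er : ninv p = (ninv r).+3 by rewrite (ninv_desc di) (ninv_desc d1) (ninv_desc d2).
have gE : gperm g p = g i * (g j * (g i * gperm g r)).
  by rewrite (gperm_desc g_comm g_braid di) (gperm_desc g_comm g_braid d1) (gperm_desc
    g_comm g_braid d2).
have := ecol_qsym eij z1 z2 z3 => /(congr1 ( *%R^~ (gperm g r))).
rewrite mul0r -mulrA /qsym !mulrDl mul1r !mulrDr -!mulrA -gE => h.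
rewrite /gbasis er (_ : ecol psi * gperm g p = - (ecol psi * gperm g r
  + ecol psi * (g i * gperm g r) + ecol psi * (g j * gperm g r)
  + ecol psi * (g i * (g j * gperm g r)) + ecol psi * (g j * (g i * gperm g r)))).
  apply: spanN; do !apply: SpanD; try exact: ecol_gg; try exact: ecol_g_shorter.
  by apply: SpanGen; exists psi, r; split => //; lia.
by apply/eqP; rewrite -addr_eq0 addrC h.
Qed.

Lemma gbasis_avoiding psi p : linspan avoiding (gbasis psi p).
Proof.
have [m] := ubnP (ninv p); elim: m psi p => // m IH psi p /ltnSE le_pm.
have [hp|np] := boolP (has_pattern psi p); last by apply: SpanGen; exists psi, p.
apply: span_bind (gbasis_pattern hp) => _ [psi' [p' [lt ->]]].
by apply: IH; apply: leq_trans lt le_pm.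
Qed.

Lemma span_avoiding_g i x : linspan avoiding x -> linspan avoiding (g i * x).
Proof.
apply: span_mul => _ [psi [p [_ ->]]]; apply: span_bind (g_gbasis i psi p).
by move=> _ [psi' [p' [_ ->]]]; apply: gbasis_avoiding.
Qed.

Lemma span_avoiding_t j x : linspan avoiding x -> linspan avoiding (t j * x).
Proof.
apply: span_mul => _ [psi [p [np ->]]].
have te : t j * ecol psi = ecol psi * t j.
  by apply: commr_prod => k _; apply: t_eproj.
rewrite /gbasis mulrA te ecol_t -mulrA; apply: SpanZ; apply: SpanGen.
by exists psi, p.
Qed.

Lemma span_avoiding1 : linspan avoiding 1.
Proof.
rewrite -ecol_sum; apply: span_sum => psi _.
rewrite -[ecol psi]mulr1 -(gperm1 g); exact: gbasis_avoiding.
Qed.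

End Spanning.

(** * The action on words *)

Section WordRepresentation.
Variables (R : comNzRingType) (n d : nat) (L : finType) (cl : L -> 'I_d).
Variables q : R.
Local Notation word := {ffun 'I_n -> L}.
Local Notation V := {ffun word -> R^o}.
Implicit Types (i : 'I_n.-1) (j : 'I_n) (p : 'S_n) (x y z : L) (u v : word) (f : V).

Definition wadj i u : word := [ffun j => u (adj i j)].

(** With [stay_coef], the matrix of [g i] on two neighbouring letters, ordered by [enum_rank]. For
    distinct colours, where [e_i] acts by zero, the diagonal vanishes and the square is [q]; for
    equal letters the eigenvalue [-1] solves the quadratic relation. *)
Definition swap_coef x y : R :=
  if (enum_rank x < enum_rank y)%N then 1 else
  if (enum_rank y < enum_rank x)%N then q else 0.
Definition stay_coef x y : R :=
  if (enum_rank x < enum_rank y)%N then 0 else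
  if (enum_rank y < enum_rank x)%N then (if cl x == cl y then q - 1 else 0) else -1.

Definition opg i f : V :=
  [ffun u : word => swap_coef (u (posl i)) (u (posr i)) * f (wadj i u)
             + stay_coef (u (posl i)) (u (posr i)) * f u].

Lemma opgE i f u : opg i f u = swap_coef (u (posl i)) (u (posr i)) * f (wadj i u)
             + stay_coef (u (posl i)) (u (posr i)) * f u.
Proof. by rewrite ffunE. Qed.

Lemma wadjK i u : wadj i (wadj i u) = u.
Proof. by apply/ffunP => j; rewrite !ffunE adjKl. Qed.

Lemma wadj_far (i i' : 'I_n.-1) u : (i.+1 < i')%N || (i'.+1 < i)%N ->
  wadj i (wadj i' u) = wadj i' (wadj i u).
Proof.
by move=> far; apply/ffunP => j; rewrite !ffunE -!permM adj_far.
Qed.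

Lemma wadj_braid (i i' : 'I_n.-1) u : i' = i.+1 :> nat ->
  wadj i (wadj i' (wadj i u)) = wadj i' (wadj i (wadj i' u)).
Proof.
by move=> e; apply/ffunP => j; rewrite !ffunE;
  have := congr1 (fun p : 'S_n => p j) (adj_braid e); rewrite !permM => ->.
Qed.

Lemma opg_far (i i' : 'I_n.-1) f : (i.+1 < i')%N || (i'.+1 < i)%N ->
  opg i (opg i' f) = opg i' (opg i f).
Proof.
move=> far; apply/ffunP => u; rewrite !opgE (wadj_far _ far) !ffunE.
have far' : (i'.+1 < i)%N || (i.+1 < i')%N by rewrite orbC.
have fixl (a b : 'I_n.-1) : (a.+1 < b)%N || (b.+1 < a)%N -> adj a (posl b) = posl b.
  by move=> h; rewrite /adj tpermD // -val_eqE /=; lia.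
have fixr (a b : 'I_n.-1) : (a.+1 < b)%N || (b.+1 < a)%N -> adj a (posr b) = posr b.
  by move=> h; rewrite /adj tpermD // -val_eqE /=; lia.
rewrite !fixl // !fixr //.
ring.
Qed.

Lemma adj_braid_pos (i i' : 'I_n.-1) : i' = i.+1 :> nat ->
  [/\ posl i' = posr i, adj i (posr i') = posr i', adj i' (posl i) = posl i,
      adj i' (posr i) = posr i' & adj i' (posr i') = posr i].
Proof.
move=> e; have ji : posl i' = posr i by apply: ord_inj.
split => //; try by rewrite /adj tpermD // -val_eqE /=; lia.
  by rewrite -ji adj_posl.
by rewrite -ji adj_posr.
Qed.

Lemma rank_inj x y : enum_rank x = enum_rank y :> nat -> x = y.
Proof. by move/ord_inj/enum_rank_inj. Qed.

Lemma opg_braid (i i' : 'I_n.-1) f : i' = i.+1 :> nat ->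
  opg i (opg i' (opg i f)) = opg i' (opg i (opg i' f)).
Proof.
move=> e; have [e0 e1 e2 e3 e4] := adj_braid_pos e.
apply/ffunP => u; rewrite !opgE !wadjK -(wadj_braid _ e) !ffunE.
rewrite !e0 !(e1, e2, e3, e4, adj_posl, adj_posr).
set x := u (posl i); set y := u (posr i); set z := u (posr i').
(* With the values of [f] at the six rearrangements as independent variables, the claim is a
   polynomial identity in [q] for each relative order and each coincidence of colours. *)
move: (f u) (f (wadj i u)) (f (wadj i' u)) (f (wadj i (wadj i' u)))
  (f (wadj i' (wadj i u))) (f (wadj i (wadj i' (wadj i u)))) => f0 f1 f2 f3 f4 f5.
move: x y z => x y z; rewrite /swap_coef /stay_coef.
rewrite (eq_sym (cl z) (cl y)) (eq_sym (cl y) (cl x)).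
have [hxy|hxy|/rank_inj hxy] := ltngtP (enum_rank x) (enum_rank y);
have [hyz|hyz|/rank_inj hyz] := ltngtP (enum_rank y) (enum_rank z);
have [hxz|hxz|/rank_inj hxz] := ltngtP (enum_rank x) (enum_rank z); try (subst; lia).
all: try subst x; try subst y; try subst z.
all: rewrite ?eqxx.
all: try ring.
all: try (have [c1|c1] := eqVneq (cl x) (cl y); rewrite ?c1 ?eqxx); try ring.
all: try (have [c2|c2] := eqVneq (cl y) (cl z); rewrite ?c2 ?eqxx); try ring.
all: try (have [c3|c3] := eqVneq (cl x) (cl z); rewrite ?c3 ?eqxx); try ring.
(* The remaining colour assignments contradict the transitivity of equality. *)
all: by case/negP: c1; rewrite c2 c3.
Qed.

Variable w : R.

Definition opd (h : word -> R) f : V := [ffun u : word => h u * f u].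
Definition opt j : V -> V := opd (fun u => w ^+ cl (u j)).

Lemma opdE h f u : opd h f u = h u * f u.
Proof. by rewrite ffunE. Qed.

(** The swap terms agree. If [adj i] moves [j], the diagonal term either vanishes or belongs to two
    letters of one colour, on which the two operators [opt] have the same eigenvalue. *)
Lemma opt_opg i j f : opg i (opt j f) = opt (adj i j) (opg i f).
Proof.
apply/ffunP => u; rewrite !(opgE, opdE) ffunE mulrDr.
rewrite mulrCA; congr (_ + _); rewrite mulrCA.
have [->//|nj] := eqVneq (adj i j) j.
have : j = posl i \/ j = posr i.
  by move: nj; rewrite /adj; case: tpermP; rewrite ?eqxx; auto.
rewrite /stay_coef.
have [lt|lt|/rank_inj e] := ltngtP (enum_rank (u (posl i))) (enum_rank (u (posr i))).
- by rewrite !mul0r !mulr0.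
- have [e|_] := eqVneq (cl (u (posl i))) (cl (u (posr i)));
    last by rewrite !mul0r !mulr0.
  by case=> ->; rewrite ?adj_posl ?adj_posr e.
by case=> ->; rewrite ?adj_posl ?adj_posr e.
Qed.

Lemma opt_comm (j k : 'I_n) f : opt j (opt k f) = opt k (opt j f).
Proof. by apply/ffunP => u; rewrite !opdE mulrCA. Qed.

Lemma opg_quad i f :
  opg i (opg i f) = [ffun u : word => q * f u
    + (q - 1) * opg i (opd (fun u => (cl (u (posl i)) == cl (u (posr i)))%:R) f) u].
Proof.
apply/ffunP => u; rewrite !(ffunE, opgE, opdE) !wadjK /= adj_posl adj_posr.
move: (u (posl i)) (u (posr i)) (f u) (f (wadj i u)) => x y f0 f1.
rewrite /swap_coef /stay_coef (eq_sym (cl y) (cl x)).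
have [hxy|hxy|/rank_inj hxy] := ltngtP (enum_rank x) (enum_rank y).
all: have [c|c] := eqVneq (cl x) (cl y); rewrite /= ?mulr1n ?mulr0n; try ring.
by rewrite hxy eqxx in c.
Qed.

Hypothesis cl0_pair : forall x y z, cl x = 0%N :> nat -> cl y = 0%N :> nat ->
  cl z = 0%N :> nat -> [|| x == y, x == z | y == z].

(** Among three letters of colour zero one is repeated. In this sign convention the symmetrizer
    corresponds to the third q-exterior power of a space of rank two, which is zero. *)
Lemma opg_qsym (i i' : 'I_n.-1) f : i' = i.+1 :> nat ->
  let f' := opd (fun u => [&& cl (u (posl i)) == 0%N :> nat,
    cl (u (posl i)) == cl (u (posr i)) & cl (u (posl i')) == cl (u (posr i'))]%:R) f in
  forall u, f' u + opg i f' u + opg i' f' u + opg i' (opg i f') u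
    + opg i (opg i' f') u + opg i (opg i' (opg i f')) u = 0.
Proof.
move=> e f' u; have [e0 e1 e2 e3 e4] := adj_braid_pos e.
rewrite !opgE !wadjK !opdE !ffunE.
rewrite !e0 !(e1, e2, e3, e4, adj_posl, adj_posr).
set x := u (posl i); set y := u (posr i); set z := u (posr i').
move: (f u) (f (wadj i u)) (f (wadj i' u)) (f (wadj i (wadj i' u)))
  (f (wadj i' (wadj i u))) (f (wadj i (wadj i' (wadj i u)))) => f0 f1 f2 f3 f4 f5.
move: x y z => x y z.
have dE a b c : [&& cl a == 0%N :> nat, cl a == cl b & cl b == cl c] =
    [&& cl a == 0%N :> nat, cl b == 0%N :> nat & cl c == 0%N :> nat].
  rewrite -!val_eqE /=; case: eqP => //= ->; rewrite eq_sym.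
  by case: eqP => //= ->; rewrite eq_sym.
rewrite !dE; have [zx|_] := eqVneq (cl x : nat) 0%N;
  last by rewrite /= ?andbF /= ?mulr0n; ring.
have [zy|_] := eqVneq (cl y : nat) 0%N; last by rewrite /= ?andbF /= ?mulr0n; ring.
have [zz|_] := eqVneq (cl z : nat) 0%N; last by rewrite /= ?andbF /= ?mulr0n; ring.
have eqc a b : cl a = 0%N :> nat -> cl b = 0%N :> nat -> cl a == cl b.
  by move=> za zb; apply/eqP/ord_inj; rewrite za zb.
have:= cl0_pair zx zy zz; rewrite /swap_coef /stay_coef !eqc //= mulr1n.
case/or3P => /eqP ?.
- subst y; rewrite !ltnn; have [h|h|h] := ltngtP (enum_rank x) (enum_rank z); ring.
- subst z; rewrite !ltnn; have [h|h|h] := ltngtP (enum_rank x) (enum_rank y); ring.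
- subst z; rewrite !ltnn; have [h|h|h] := ltngtP (enum_rank x) (enum_rank y); ring.
Qed.

End WordRepresentation.

(** * Matrix coefficients of products of generators *)

Section MatrixCoefficients.
Variables (R : comNzRingType) (n d : nat) (L : finType) (cl : L -> 'I_d).
Variables q : R.
Local Notation word := {ffun 'I_n -> L}.
Local Notation V := {ffun word -> R^o}.
Implicit Types (i : 'I_n.-1) (j : 'I_n) (p v : 'S_n) (u z : word) (f : V).
Local Notation opg := (opg cl q).

Definition opw (s : seq 'I_n.-1) f : V := foldl (fun f i => opg i f) f s.

Definition delta z : V := [ffun u => (u == z)%:R].

Lemma opw_lin s (a b : R) f1 f2 :
  opw s [ffun u => a * f1 u + b * f2 u] = [ffun u => a * opw s f1 u + b * opw s f2 u].
Proof.
elim: s f1 f2 => // i s IH f1 f2; rewrite /= -IH; congr (opw s _).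
by apply/ffunP => u; rewrite !ffunE; ring.
Qed.

Lemma opg_delta i z : opg i (delta z) =
  [ffun u => swap_coef q (z (posr i)) (z (posl i)) * delta (wadj i z) u
    + stay_coef cl q (z (posl i)) (z (posr i)) * delta z u].
Proof.
apply/ffunP => u; rewrite !ffunE; congr (_ + _); last first.
  by have [->|_] := eqVneq u z; rewrite // !mulr0.
have -> : (wadj i u == z) = (u == wadj i z).
  by apply/eqP/eqP => [<-|->]; rewrite wadjK.
have [->|_] := eqVneq u (wadj i z); last by rewrite !mulr0.
by rewrite !ffunE adj_posl adj_posr.
Qed.

(** Each letter of [s] either rearranges the word or leaves it, so only rearrangements by subwords
    of [s] occur, and only the full subword can have length [size s]. *)
Lemma opw_delta_support s z u : opw s (delta z) u != 0 ->
  exists v, [/\ u \o v =1 z, (ninv v <= size s)%N & ninv v = size s -> v = pword s].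
Proof.
elim: s z => [|i s IH] z.
  rewrite /= ffunE; have [-> _|] := eqVneq u z; last by rewrite eqxx.
  by exists 1%g; rewrite ninv_1 pword_nil; split=> // j /=; rewrite perm1.
rewrite /= -/(opw s _) opg_delta opw_lin ffunE => nz.
have [h1|/IH[v [vE le_v _]]] := eqVneq (opw s (delta z) u) 0; last first.
  by exists v; split => // [|e]; [exact: leqW | move: le_v; rewrite e ltnn].
have [h2|/IH[v [vE le_v eq_v]]] := eqVneq (opw s (delta (wadj i z)) u) 0.
  by move: nz; rewrite h1 h2 !mulr0 addr0 eqxx.
exists (adj i * v)%g; split.
- by move=> j /=; rewrite permM -[u _]/((u \o v) _) vE ffunE adjKl.
- exact: leq_trans (ninv_adj_le _ _) _.
move=> e; rewrite pword_cons -eq_v //.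
by apply/eqP; rewrite eqn_leq le_v; have := ninv_adj_le i v; rewrite e.
Qed.

(** By the minimality of [pword s] no proper subword reaches [u], so every letter contributes
    through its swap coefficient alone. *)
Lemma opw_delta_diag s z u : reduced s -> incr_on z (pword s) ->
  u \o pword s =1 z -> exists k, opw s (delta z) u = q ^+ k.
Proof.
elim: s z => [|i s IH] z rs incz uE.
  exists 0%N; rewrite /= ffunE (_ : u = z) ?eqxx //.
  by apply/ffunP => j; rewrite -uE /= pword_nil perm1.
have /andP[rs' nd] : reduced s && ~~ desc i (pword s) by rewrite -reduced_cons.
rewrite /= -/(opw s _) opg_delta opw_lin ffunE.
have -> : opw s (delta z) u = 0.
  apply/eqP/negP => /negP /opw_delta_support[v [vE le_v _]].
  have uv : u \o pword (i :: s) =1 u \o v by move=> j; rewrite uE vE.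
  have incu : incr_on (u \o pword (i :: s)) (pword (i :: s)).
    by move=> a b lt; rewrite !uE; apply: incz.
  have [h _] := ninv_incr_min incu uv.
  by move: (leq_trans h le_v); rewrite (eqP rs) /= ltnn.
rewrite mulr0 addr0.
have dp : (pword (i :: s) (posr i) < pword (i :: s) (posl i))%N.
  by have := desc_adj i (pword s); rewrite (negPf nd) /= -pword_cons.
(* A permutation that is increasing on equal letters can only have a descent between different
   letters, so the swap coefficient is [1] or [q]. *)
have zne : z (posl i) != z (posr i).
  apply: contraTneq dp => e; rewrite -leqNgt ltnW //.
  by apply: incz e; apply: posl_lt_posr.
have [||k ->] := IH (wadj i z) rs'.
- move=> a b lt; rewrite !ffunE => e; have := incz (adj i a) (adj i b).
  rewrite pword_cons !permM !adjKl; apply => //; apply: adj_lt lt _.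
  by apply: contraNneq zne => -[ea eb]; move: e; rewrite ea eb adj_posl adj_posr => ->.
- by move=> j; rewrite ffunE -uE /= pword_cons permM adjKl.
rewrite /swap_coef; have [lt|lt|/rank_inj e] := ltngtP.
- by exists k; rewrite mul1r.
- by exists k.+1; rewrite exprS.
by rewrite e eqxx in zne.
Qed.

End MatrixCoefficients.

(** * Right actions of free and quotient algebras *)

Section RightActions.
Variables (R : comNzRingType) (V : lmodType R).

(** Acting on the right makes the factors of a product operate in reading order, as in [opw]. *)
Record raction (A : alg R) := RAction {
  ract :> V -> A -> V;
  ractB : forall v x y, ract v (x - y) = ract v x - ract v y;
  ract1 : forall v, ract v 1 = v;
  ractM : forall v x y, ract v (x * y) = ract (ract v x) y;
  ractZ : forall v a x, ract v (alg_cst A a * x) = a *: ract v x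
}.

Lemma ract0 A (r : raction A) v : r v 0 = 0.
Proof. by have := ractB r v 0 0; rewrite !subrr. Qed.

Lemma ractN A (r : raction A) v x : r v (- x) = - r v x.
Proof. by rewrite -sub0r ractB ract0 sub0r. Qed.

Lemma ractD A (r : raction A) v x y : r v (x + y) = r v x + r v y.
Proof. by rewrite -{1}[y]opprK ractB ractN opprK. Qed.

Lemma ract_sum A (r : raction A) v (I : Type) (s : seq I) (F : I -> A) :
  r v (\sum_(i <- s) F i) = \sum_(i <- s) r v (F i).
Proof.
elim: s => [|i s IH]; first by rewrite !big_nil ract0.
by rewrite !big_cons ractD IH.
Qed.

Lemma ract_cst A (r : raction A) v a : r v (alg_cst A a) = a *: v.
Proof. by rewrite -[alg_cst A a]mulr1 ractZ ract1. Qed.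

Section Quotient.
Variables (A : alg R) (r : raction A) (S : A -> Prop).
Hypothesis S_kill : forall x, S x -> forall v, r v x = 0.

Hypothesis r0 : forall x, r 0 x = 0.

(** Left multiples vanish because [S] kills every vector, right multiples because [0] is fixed. *)
Lemma ract_ideal x : ideal_gen S x -> forall v, r v x = 0.
Proof.
elim=> [y /S_kill//||y z _ hy _ hz|a y _ hy|a y _ hy] v.
- exact: ract0.
- by rewrite ractB hy hz subrr.
- by rewrite ractM hy.
- by rewrite ractM hy r0.
Qed.

Definition qact (v : V) (x : quot_alg S) : V := r v (repr (x : quot_ring S)).

Lemma qact_pi v x : qact v (quot_pi S x) = r v x.
Proof.
apply/eqP; rewrite -subr_eq0 -ractB; apply/eqP/ract_ideal.
by apply/quot_piP; rewrite quot_reprK.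
Qed.

Fact qactB v x y : qact v (x - y) = qact v x - qact v y.
Proof.
by rewrite -[x](@quot_reprK _ _ S) -[y](@quot_reprK _ _ S) -quot_piB !qact_pi ractB.
Qed.

Fact qact1 v : qact v 1 = v.
Proof. by rewrite -[1]/(quot_pi S 1) qact_pi ract1. Qed.

Fact qactM v x y : qact v (x * y) = qact (qact v x) y.
Proof.
rewrite -[x](@quot_reprK _ _ S) -[y](@quot_reprK _ _ S).
by rewrite -[_ * _](quot_piM) !qact_pi ractM.
Qed.

Fact qactZ v a x : qact v (alg_cst (quot_alg S) a * x) = a *: qact v x.
Proof.
rewrite -[x](@quot_reprK _ _ S) -[alg_cst _ a]/(quot_pi S (alg_cst A a)).
by rewrite -[_ * _](quot_piM) !qact_pi ractZ.
Qed.

Definition quot_raction : raction (quot_alg S) :=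
  RAction qactB qact1 qactM qactZ.

End Quotient.

Section Free.
Variables (I : choiceType) (op : I -> V -> V).
Hypothesis op_lin : forall i a u v, op i (a *: u + v) = a *: op i u + op i v.

Definition wact (v : V) (s : seq I) : V := foldl (fun v i => op i v) v s.

Lemma wact_lin s a u v : wact (a *: u + v) s = a *: wact u s + wact v s.
Proof. by elim: s u v => // i s IH u v; rewrite /= op_lin IH. Qed.

Lemma wact0 s : wact 0 s = 0.
Proof. by have := wact_lin s (-1) 0 0; rewrite scaler0 addr0 scaleN1r addNr. Qed.

Lemma wactD s u v : wact (u + v) s = wact u s + wact v s.
Proof. by have := wact_lin s 1 u v; rewrite !scale1r. Qed.

Lemma wactZ s a u : wact (a *: u) s = a *: wact u s.
Proof. by have := wact_lin s a u 0; rewrite wact0 !addr0. Qed.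

Definition free_act (v : V) (x : free_alg R I) : V :=
  \sum_(k <- msupp (x : {malg R[{fmonom I}]})) (x : {malg R[{fmonom I}]})@_k *: wact v
    k.

Lemma free_actEw v (x : {malg R[{fmonom I}]}) (e : {fset {fmonom I}}) :
  (msupp x `<=` e)%fset -> free_act v x = \sum_(k <- e) x@_k *: wact v k.
Proof.
move=> le; rewrite /free_act (big_fset_incl _ le) //= => k _.
by move=> /mcoeff_outdom ->; rewrite scale0r.
Qed.

Fact free_actB v x y : free_act v (x - y) = free_act v x - free_act v y.
Proof.
set e := (msupp (x : {malg R[{fmonom I}]}) `|` msupp (y : {malg R[{fmonom I}]}))%fset.
rewrite (@free_actEw v x e) ?fsubsetUl // (@free_actEw v y e) ?fsubsetUr //.
rewrite (@free_actEw v (x - y) e) ?msuppB_le // -sumrB.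
by apply/eq_bigr => k _; rewrite mcoeffB scalerBl.
Qed.

HB.instance Definition _ v := GRing.isZmodMorphism.Build {malg R[{fmonom I}]} V
  (free_act v) (@free_actB v).

Lemma free_actU v (c : R) (k : {fmonom I}) : free_act v << c *g k >> = c *: wact v k.
Proof. by rewrite (free_actEw v msuppU_le) big_seq_fset1 mcoeffUU. Qed.

Fact free_act1 v : free_act v 1 = v.
Proof.
rewrite -(rmorph1 (alg_cst (free_alg R I))).
rewrite -[alg_cst _ 1]/(<< 1 *g @mone {fmonom I} >> : {malg R[{fmonom I}]}).
by rewrite free_actU scale1r fm1.
Qed.

Fact free_actM v x y : free_act v (x * y) = free_act (free_act v x) y.
Proof.
have lin (r : seq {fmonom I}) (F : {fmonom I} -> R) (G : {fmonom I} -> V) s :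
    wact (\sum_(k <- r) F k *: G k) s = \sum_(k <- r) F k *: wact (G k) s.
  elim: r => [|k r IH]; first by rewrite !big_nil wact0.
  by rewrite !big_cons wactD IH wactZ.
rewrite [x * y]malgME [LHS]raddf_sum /=.
transitivity (\sum_(k1 <- msupp (x : {malg R[{fmonom I}]}))
    \sum_(k2 <- msupp (y : {malg R[{fmonom I}]}))
    (x : {malg R[{fmonom I}]})@_k1 *: ((y : {malg R[{fmonom I}]})@_k2 *: wact (wact v
      k1) k2)).
  apply: eq_bigr => k1 _; rewrite [LHS]raddf_sum /=; apply: eq_bigr => k2 _.
  by rewrite free_actU scalerA fmM /wact foldl_cat.
rewrite exchange_big /=; apply: eq_bigr => k2 _.
rewrite lin scaler_sumr; apply: eq_bigr => k1 _.
by rewrite !scalerA mulrC.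
Qed.

Fact free_actZ v a x : free_act v (alg_cst (free_alg R I) a * x) = a *: free_act v x.
Proof.
rewrite free_actM -[alg_cst _ a]/(<< a *g @mone {fmonom I} >> : {malg R[{fmonom I}]})
  free_actU fm1 /=.
rewrite /free_act scaler_sumr; apply: eq_bigr => k _.
by rewrite wactZ !scalerA mulrC.
Qed.

Definition free_raction : raction (free_alg R I) :=
  RAction free_actB free_act1 free_actM free_actZ.

Lemma free_ractE v i : free_raction v (free_gen R i) = op i v.
Proof. by rewrite [LHS]free_actU scale1r fmU. Qed.

Lemma free_ract0 x : free_raction 0 x = 0.
Proof. by rewrite [LHS]big1 // => k _; rewrite wact0 scaler0. Qed.

End Free.
End RightActions.

(** Monomials arise from [1] by left multiplication with generators, which matches the closure
    properties proved for the span of the elements [avoiding]. *)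
Lemma free_alg_ind (R : comNzRingType) (I : choiceType) (P : free_alg R I -> Prop) :
  P 1 -> (forall x y, P x -> P y -> P (x + y)) ->
  (forall c x, P x -> P (alg_cst _ c * x)) ->
  (forall i x, P x -> P (free_gen R i * x)) -> forall x, P x.
Proof.
move=> P1 PD PZ PM x.
have P0 : P 0 by rewrite -[0](mul0r 1) -(rmorph0 (alg_cst (free_alg R I))); apply: PZ.
have Pk (k : {fmonom I}) : P (<< k >> : {malg R[{fmonom I}]}).
  case: k => s; elim: s => [|i s IH].
    have <- : (1 : free_alg R I) = (<< FMonom [::] >> : {malg R[{fmonom I}]}).
      rewrite -(rmorph1 (alg_cst (free_alg R I))).
      rewrite -[alg_cst _ 1]/(<< 1 *g @mone {fmonom I} >> : {malg R[{fmonom I}]}).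
      by congr << _ *g _ >>; apply: val_inj; rewrite /= fm1.
    exact: P1.
  have -> : (<< FMonom (i :: s) >> : {malg R[{fmonom I}]}) =
      (free_gen R i : {malg R[{fmonom I}]}) * << FMonom s >>.
    rewrite malgM_def fgmulUU mul1r; congr << _ *g _ >>.
    by apply: val_inj; rewrite /= fmM fmU.
  exact: PM.
rewrite [x]monalgE; elim/big_rec: _ => // k y _ Py; apply: PD Py.
have -> : (<< (x : {malg R[{fmonom I}]})@_k *g k >> : {malg R[{fmonom I}]}) =
    alg_cst (free_alg R I) ((x : {malg R[{fmonom I}]})@_k) * (<< k >> : {malg R[{fmonom
      I}]}).
  by rewrite -[alg_cst _ _]/(<< _ *g @mone {fmonom I} >> : {malg R[{fmonom I}]})
    malgM_def fgmulUU mulr1 mul1m.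
exact: PZ.
Qed.

(** * The defining relations in any algebra acting through the operators on words *)

Section ActionRelations.
Variables (R : comNzRingType) (n d : nat) (L : finType) (cl : L -> 'I_d).
Variables (q w wb dv : R).
Hypothesis d_gt0 : (0 < d)%N.
Hypothesis w_d : w ^+ d = 1.
Hypothesis w_inv : w * wb = 1.
Hypothesis w_orth : forall a b : 'I_d,
  dv * \sum_(s < d) (w ^+ a * wb ^+ b) ^+ s = (a == b)%:R.
Hypothesis cl0_pair : forall x y z : L, cl x = 0%N :> nat -> cl y = 0%N :> nat ->
  cl z = 0%N :> nat -> [|| x == y, x == z | y == z].
Local Notation word := {ffun 'I_n -> L}.
Local Notation V := {ffun word -> R^o}.
Local Notation opg := (@opg R n d L cl q).
Local Notation opt := (@opt R n d L cl w).
Variables (A : alg R) (r : raction V A) (g : 'I_n.-1 -> A) (t : 'I_n -> A).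
Hypothesis rg : forall v i, r v (g i) = opg i v.
Hypothesis rt : forall v j, r v (t j) = opt j v.
Implicit Types (i : 'I_n.-1) (j : 'I_n) (v : V) (u : word).

Lemma ffun_scaleE a v u : (a *: v) u = a * v u.
Proof. by rewrite ffunE. Qed.

Lemma ffun_sumE (I : Type) (s : seq I) (f : I -> V) u :
  (\sum_(k <- s) f k) u = \sum_(k <- s) f k u.
Proof.
elim: s => [|k s IH]; first by rewrite !big_nil ffunE.
by rewrite !big_cons ffunE IH.
Qed.

Lemma ract_tX v j s u : r v (t j ^+ s) u = w ^+ (cl (u j) * s) * v u.
Proof.
elim: s v => [|s IH] v; first by rewrite expr0 ract1 muln0 expr0 mul1r.
by rewrite exprSr ractM rt opdE IH mulrA -exprD mulnS.
Qed.

Lemma w_pred : w ^+ d.-1 = wb.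
Proof. by rewrite -[LHS]mulr1 -w_inv mulrA -exprSr prednK // w_d mul1r. Qed.

Lemma ract_e v i u :
  r v (avg_e d t dv i) u = (cl (u (posl i)) == cl (u (posr i)))%:R * v u.
Proof.
rewrite /avg_e ractZ ffun_scaleE ract_sum ffun_sumE -w_orth -mulrA; congr (_ * _).
rewrite mulr_suml; apply: eq_bigr => s _.
rewrite ractM -exprM !ract_tX mulrA; congr (_ * _).
by rewrite mulnCA exprM w_pred mulrC exprMn -!exprM.
Qed.

Lemma ract_T v j u : r v (avg_T d t dv j) u = (cl (u j) == 0%N :> nat)%:R * v u.
Proof.
have -> : (cl (u j) == 0%N :> nat) = (cl (u j) == Ordinal d_gt0) by [].
rewrite /avg_T ractZ ffun_scaleE ract_sum ffun_sumE -w_orth -mulrA; congr (_ * _).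
rewrite mulr_suml; apply: eq_bigr => s _.
by rewrite ract_tX expr0 mulr1 exprM.
Qed.

Lemma ract_g_far v i i' : (i.+1 < i')%N || (i'.+1 < i)%N ->
  r v (g i * g i' - g i' * g i) = 0.
Proof. by move=> far; rewrite ractB !ractM !rg (opg_far cl q v far) subrr. Qed.

Lemma ract_g_braid v i i' : i' = i.+1 :> nat ->
  r v (g i * g i' * g i - g i' * g i * g i') = 0.
Proof. by move=> e; rewrite ractB !ractM !rg (opg_braid cl q v e) subrr. Qed.

Lemma ract_t_comm v j (k : 'I_n) : r v (t j * t k - t k * t j) = 0.
Proof. by rewrite ractB !ractM !rt opt_comm subrr. Qed.

Lemma ract_t_g v i j : r v (t j * g i - g i * t (adj i j)) = 0.
Proof. by rewrite ractB !ractM !rg !rt opt_opg subrr. Qed.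

Lemma ract_t_d v j : r v (t j ^+ d - 1) = 0.
Proof.
apply/ffunP => u; rewrite ractB !ffunE ract_tX ract1 mulnC exprM w_d.
by rewrite expr1n mul1r subrr.
Qed.

Lemma ract_g_quad v i : r v (g i ^+ 2 - (alg_cst A q +
  alg_cst A (q - 1) * avg_e d t dv i * g i)) = 0.
Proof.
rewrite ractB expr2 ractM !rg ractD ract_cst -mulrA ractZ ractM rg.
have -> : r v (avg_e d t dv i) =
    opd (fun u => (cl (u (posl i)) == cl (u (posr i)))%:R) v.
  by apply/ffunP => u; rewrite ract_e opdE.
apply/eqP; rewrite subr_eq0; apply/eqP/ffunP => u; rewrite opg_quad.
by rewrite !ffunE.
Qed.

(** The idempotents restrict a vector to the words with colour zero at the first three positions,
    where [opg_qsym] applies. *)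
Lemma ract_kill v j (i1 i2 : 'I_n.-1) :
  j = 0%N :> nat -> i1 = 0%N :> nat -> i2 = 1%N :> nat ->
  r v (avg_T d t dv j * avg_e d t dv i1 * avg_e d t dv i2 * qsym g i1 i2) = 0.
Proof.
move=> hj h1 h2; have ej : j = posl i1 by apply: ord_inj; rewrite hj /= h1.
have e12 : i2 = i1.+1 :> nat by rewrite h1 h2.
rewrite ractM; have -> : r v (avg_T d t dv j * avg_e d t dv i1 * avg_e d t dv i2) =
    opd (fun u => [&& cl (u (posl i1)) == 0%N :> nat,
      cl (u (posl i1)) == cl (u (posr i1)) & cl (u (posl i2)) == cl (u (posr i2))]%:R)
        v.
  apply/ffunP => u; rewrite 2!ractM !ract_e ract_T opdE ej.
  by do 3!case: eqP => _; rewrite ?mul0r ?mul1r ?mul0r.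
rewrite /qsym !ractD !ractM !rg ract1; apply/ffunP => u.
have addE (f1 f2 : V) : (f1 + f2) u = f1 u + f2 u by rewrite ffunE.
have -> : (0 : V) u = 0 by rewrite ffunE.
by rewrite !addE; apply: opg_qsym.
Qed.

Lemma opg_lin i a (f1 f2 : V) : opg i (a *: f1 + f2) = a *: opg i f1 + opg i f2.
Proof.
apply/ffunP => u; rewrite !(opgE, ffunE) -![a *: (_ : R^o)]/(a * _).
ring.
Qed.

Lemma opt_lin j a (f1 f2 : V) : opt j (a *: f1 + f2) = a *: opt j f1 + opt j f2.
Proof.
apply/ffunP => u; rewrite !ffunE -![a *: (_ : R^o)]/(a * _).
ring.
Qed.

Lemma ract_eproj v j (c : 'I_d) u :
  r v (eproj d t dv wb j c) u = (cl (u j) == c)%:R * v u.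
Proof.
rewrite /eproj ractZ ffun_scaleE ract_sum ffun_sumE -w_orth -mulrA; congr (_ * _).
rewrite mulr_suml; apply: eq_bigr => s _.
rewrite exprMn_comm; last exact: alg_central.
rewrite -rmorphXn ractZ ffun_scaleE ract_tX exprMn -!exprM mulrA.
by congr (_ * _); rewrite mulrC.
Qed.

Lemma ract_ecol v (psi : {ffun 'I_n -> 'I_d}) u :
  r v (ecol t dv wb psi) u = [forall j, cl (u j) == psi j]%:R * v u.
Proof.
have -> : [forall j, cl (u j) == psi j] =
    all (fun j => cl (u j) == psi j) (index_enum 'I_n).
  apply/forallP/allP => h j; [by []|by apply: h; rewrite mem_index_enum].
rewrite /ecol; elim: (index_enum _) v => [|j s IH] v.
  by rewrite big_nil ract1 mul1r.
rewrite big_cons ractM IH ract_eproj mulrA /=; congr (_ * _).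
by case: (cl (u j) == psi j); rewrite ?mulr1 ?mulr0.
Qed.

Lemma ract_gword v s : r v (gword g s) = opw cl q s v.
Proof.
elim: s v => [|i s IH] v; first by rewrite /gword big_nil ract1.
by rewrite gword_cons ractM rg IH.
Qed.

(** The idempotent fixes or kills [delta z] according to the colours of [z]; what remains is a
    coefficient of the reduced word of [p]. *)
Lemma ract_basis (z u : word) psi (p : 'S_n) :
  r (delta R z) (gbasis g t dv wb psi p) u =
  [forall j, cl (z j) == psi j]%:R * opw cl q (rword p) (delta R z) u.
Proof.
rewrite /gbasis ractM /gperm ract_gword.
have -> : r (delta R z) (ecol t dv wb psi) =
    [forall j, cl (z j) == psi j]%:R *: delta R z.
  apply/ffunP => y; rewrite ract_ecol ffun_scaleE !ffunE.
  by have [->|_] := eqVneq y z; rewrite ?mulr0.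
have := opw_lin cl q (rword p) ([forall j, cl (z j) == psi j]%:R) 0 (delta R z) 0.
set f1 := [ffun _ => _]; have -> : f1 = [forall j, cl (z j) == psi j]%:R *: delta R z.
  by apply/ffunP => y; rewrite ffun_scaleE !ffunE mul0r addr0.
by move=> ->; rewrite ffunE mul0r addr0.
Qed.

End ActionRelations.


(** * Base change *)

Lemma has_dim_basis (K : fieldType) (V : lmodType K) (I : finType) (B : {set I})
    (b : I -> V) :
  (forall c : I -> K, \sum_(i in B) c i *: b i = 0 -> forall i, i \in B -> c i = 0) ->
  (forall v, exists c : I -> K, v = \sum_(i in B) c i *: b i) ->
  has_dim V #|B|.
Proof.
move=> free gen; exists (fun i => b (enum_val i)); split=> [c|v]; last first.
  have [c ->] := gen v; exists (fun i => c (enum_val i)).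
  by rewrite (big_enum_val (fun i => c i *: b i)).
move=> c0 i; pose c' x := c (enum_rank_in (enum_valP i) x).
have ec j : c' (enum_val j) = c j by rewrite /c' enum_valK_in.
rewrite -ec; apply: free (enum_valP i).
rewrite (big_enum_val (fun i => c' i *: b i)) -[RHS]c0.
by apply: eq_bigr => j _; rewrite ec.
Qed.

(** * Extending linear functionals to the base change *)

Section BaseChangeFunctional.
Variables (R K : comNzRingType) (iota : {rmorphism R -> K}) (M : lmodType R).
Variable l : M -> R.
Hypothesis lD : forall m m', l (m + m') = l m + l m'.
Hypothesis lZ : forall r m, l (r *: m) = r * l m.
Local Notation KM := (K * M)%type.

Let ev (k : KM) : K := k.1 * iota (l k.2).

Let mev : {malg KM} -> K := mmap (intr : int -> K) ev.

Let mevB : {morph mev : x y / x - y}.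
Proof. by move=> x y; rewrite /mev raddfB. Qed.

Let mevU z k : mev << z *g k >> = z%:~R * ev k.
Proof. by rewrite /mev mmapU. Qed.

Let mev_null x : tensor_null iota x -> mev x = 0.
Proof.
elim=> [{}x [a b m|a m m'|a r m]||y z _ ny _ nz].
- by rewrite !mevB !mevU !mul1r /ev /= mulrDl -addrA -opprD subrr.
- by rewrite !mevB !mevU !mul1r /ev /= lD rmorphD mulrDr -addrA -opprD subrr.
- by rewrite !mevB !mevU !mul1r /ev /= lZ rmorphM mulrA subrr.
- by rewrite /mev raddf0.
- by rewrite mevB ny nz subrr.
Qed.

(** The scalar extension of [l]; such functionals detect linear independence in a tensor product
    given by generators and relations. *)
Definition bc_functional (x : base_change iota M) : K := mev (repr x).

Let bc_pi x : bc_functional (tensor_pi iota x) = mev x.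
Proof.
apply/eqP; rewrite -subr_eq0 -mevB; apply/eqP/mev_null.
by apply/tensor_piP; rewrite tensor_reprK.
Qed.

Lemma bc_functionalD x y : bc_functional (x + y) = bc_functional x + bc_functional y.
Proof.
rewrite -[x](@tensor_reprK _ _ iota) -[y](@tensor_reprK _ _ iota) -raddfD !bc_pi.
by rewrite /mev raddfD.
Qed.

Lemma bc_functionalZ c x : bc_functional (c *: x) = c * bc_functional x.
Proof.
rewrite -[x](@tensor_reprK _ _ iota) -[c *: _]/(base_change_scale _ _).
rewrite base_change_scale_pi !bc_pi /tensor_act {1}/mev raddf_sum /= /mev mmapE
  mulr_sumr.
apply: eq_bigr => k _; rewrite -/mev -/(mev _) mevU /ev /=.
by rewrite [RHS]mulrCA -mulrA.
Qed.

Lemma bc_functional_tensor a m : bc_functional (tensor iota a m) = a * iota (l m).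
Proof. by rewrite bc_pi mevU mul1r. Qed.

End BaseChangeFunctional.

(** * Generators of the base change *)

Section BaseChangeSpan.
Variables (R K : comNzRingType) (iota : {rmorphism R -> K}) (M : lmodType R).

Lemma tensorZ c a (m : M) : c *: tensor iota a m = tensor iota (c * a) m.
Proof.
by rewrite -[c *: _]/(base_change_scale _ _) /tensor base_change_scale_pi tensor_actU.
Qed.

Lemma tensorDr a (m m' : M) : tensor iota a (m + m') = tensor iota a m + tensor iota a
  m'.
Proof.
rewrite -raddfD; apply/tensor_piP; rewrite opprD addrA.
exact/TensorRel/TensorDr.
Qed.

Lemma tensor_scale a r (m : M) : tensor iota a (r *: m) = tensor iota (a * iota r) m.
Proof.
symmetry; apply/tensor_piP; exact/TensorRel/TensorZ.
Qed.

Lemma tensor0 a : tensor iota a (0 : M) = 0.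
Proof. by apply: (@addrI _ (tensor iota a 0)); rewrite -tensorDr !addr0. Qed.

Lemma base_change_ind (P : base_change iota M -> Prop) :
  (forall x y, P x -> P y -> P (x - y)) ->
  (forall c x, P x -> P (c *: x)) ->
  (forall m, P (tensor iota 1 m)) -> forall x, P x.
Proof.
move=> PB PZ PT x; rewrite -[x]tensor_reprK [repr x]monalgE raddf_sum.
have P0 : P 0 by rewrite -(scale0r (tensor iota 1 0)); apply: PZ.
have PD y z : P y -> P z -> P (y + z).
  by move=> Py Pz; rewrite -[z]opprK -[- z]sub0r; apply: (PB) => //; apply: (PB).
elim/big_rec: _ => // -[a m] y _ Py; apply: PD Py.
(* The coefficients in the free abelian group are integers, which act as scalars of [K]. *)
rewrite -[_@_ _]intz !raddfMz /= -scaler_int; apply: (PZ).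
rewrite -[tensor_pi _ _]/(tensor iota a m) -[a]mulr1 -tensorZ.
exact: PZ.
Qed.

End BaseChangeSpan.

(** * The complex reflection Temperley-Lieb algebra *)

Section LaurentConstants.
Variable F : fieldType.

Lemma laurent_const_zmod : zmod_morphism (@laurent_const F).
Proof. by move=> x y; apply: val_inj; rewrite /= polyCB tofracB. Qed.

HB.instance Definition _ := GRing.isZmodMorphism.Build F (laurent F)
  (@laurent_const F) laurent_const_zmod.

Lemma laurent_const_monoid : monoid_morphism (@laurent_const F).
Proof.
split; first by apply: val_inj; rewrite /= polyC1 tofrac1.
by move=> x y; apply: val_inj; rewrite /= polyCM tofracM.
Qed.

HB.instance Definition _ := GRing.isMonoidMorphism.Build F (laurent F)
  (@laurent_const F) laurent_const_monoid.

Lemma laurent_qV_subproof : (qvar F)^-1 \in @laurent_pred F.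
Proof.
by apply/laurent_predP; exists 1, 1%N; rewrite tofrac1 expr1 mul1r.
Qed.

Definition laurent_qV : laurent F := Laurent laurent_qV_subproof.

Lemma laurent_qK : laurent_q F * laurent_qV = 1.
Proof. by apply: val_inj; rewrite /= mulfV ?qvar_neq0. Qed.

Variables (d : nat) (om : F).
Hypothesis om_prim : d.-primitive_root om.

(** For distinct [a] and [b] the ratio [x] is a [d]-th root of unity other than [1], so its
    geometric sum vanishes. *)
Lemma root_of_unity_orth (a b : 'I_d) :
  d%:R^-1 * \sum_(s < d) (om ^+ a * om^-1 ^+ b) ^+ s = (a == b)%:R.
Proof.
have om0 : om != 0 by rewrite (prim_root_eq0 om_prim) -lt0n (prim_order_gt0 om_prim).
have [->|ne] := eqVneq a b.
  rewrite -exprMn mulfV // expr1n.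
  rewrite (eq_bigr (fun=> 1)) => [|s _]; last by rewrite expr1n.
  by rewrite sumr_const card_ord mulVf ?(prim_root_natf_neq0 om_prim).
set x := om ^+ a * om^-1 ^+ b.
have xd : x ^+ d = 1.
  rewrite exprMn -!exprM mulnC exprM (prim_expr_order om_prim) expr1n mul1r.
  by rewrite mulnC exprM exprVn (prim_expr_order om_prim) invr1 expr1n.
have x1 : x - 1 != 0.
  rewrite subr_eq0; apply: contraNneq ne => e.
  have : om ^+ a = om ^+ b by rewrite -[RHS]mul1r -e -mulrA -exprMn mulVf // expr1n
    mulr1.
  move/eqP; rewrite (eq_prim_root_expr om_prim) !modn_small //.
have := subrX1 x d; rewrite xd subrr => /esym/eqP.
by rewrite mulf_eq0 (negPf x1) => /eqP ->; rewrite mulr0.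
Qed.

Definition lw := laurent_const om.
Definition lwb := laurent_const om^-1.
Definition ldv : laurent F := laurent_const d%:R^-1.

Lemma laurent_orth (a b : 'I_d) :
  ldv * \sum_(s < d) (lw ^+ a * lwb ^+ b) ^+ s = (a == b)%:R.
Proof.
rewrite /ldv /lw /lwb -[RHS](rmorph_nat (@laurent_const F)) -root_of_unity_orth.
rewrite rmorphM rmorph_sum; congr (_ * _); apply: eq_bigr => s _.
by rewrite rmorphXn rmorphM !rmorphXn.
Qed.

Lemma lw_inv : lw * lwb = 1.
Proof.
rewrite -rmorphM mulfV ?rmorph1 //.
by rewrite (prim_root_eq0 om_prim) -lt0n (prim_order_gt0 om_prim).
Qed.

Lemma lw_d : lw ^+ d = 1.
Proof. by rewrite -rmorphXn (prim_expr_order om_prim) rmorph1. Qed.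

End LaurentConstants.

(** * Transport of relations along ring morphisms *)

Section Morphisms.
Variables (A B : pzRingType) (f : {rmorphism A -> B}).

Lemma morphM2 x y z t : f (x * y) = f (z * t) -> f x * f y = f z * f t.
Proof. by rewrite !rmorphM. Qed.

Lemma morphM3 x y z t u v : f (x * y * z) = f (t * u * v) ->
  f x * f y * f z = f t * f u * f v.
Proof. by rewrite !rmorphM. Qed.

Lemma morphX1 x k : f (x ^+ k) = f 1 -> f x ^+ k = 1.
Proof. by rewrite rmorphXn rmorph1. Qed.

Lemma morph_quad x k a b e y : f (x ^+ k) = f (a + b * e * y) ->
  f x ^+ k = f a + f b * f e * f y.
Proof. by rewrite rmorphXn rmorphD !rmorphM. Qed.

End Morphisms.

Lemma morph_sum_pow (R : comNzRingType) (A B : alg R) (f : {rmorphism A -> B}) a x d :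
  f (alg_cst A a) = alg_cst B a ->
  f (alg_cst A a * \sum_(s < d) x ^+ s) = alg_cst B a * \sum_(s < d) f x ^+ s.
Proof.
move=> fa; rewrite rmorphM fa rmorph_sum; congr (_ * _).
by apply: eq_bigr => s _; rewrite rmorphXn.
Qed.

Lemma morph_sym (A B : pzRingType) (f : {rmorphism A -> B}) x y :
  f (1 + x + y + x * y + y * x + x * y * x) =
  1 + f x + f y + f x * f y + f y * f x + f x * f y * f x.
Proof. by rewrite !(rmorphD, rmorphM, rmorph1). Qed.

Lemma morph_kill (A B : pzRingType) (f : {rmorphism A -> B}) x y z t x' y' z' t' :
  f x = x' -> f y = y' -> f z = z' -> f t = t' -> f (x * y * z * t) = 0 ->
  x' * y' * z' * t' = 0.
Proof. by rewrite !rmorphM => -> -> -> ->. Qed.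

Section IdemMorph.
Variables (F : fieldType) (d n : nat).

Lemma idem_e_morph (A B : alg (laurent F)) (f : {rmorphism A -> B}) (t : 'I_n -> A) (i
  : 'I_n.-1) :
  (forall a, f (alg_cst A a) = alg_cst B a) ->
  f (idem_e d t i) = idem_e d (f \o t) i.
Proof.
move=> fc; rewrite /idem_e (rmorphM f) fc (rmorph_sum f); congr (_ * _).
by apply: eq_bigr => s _; rewrite (rmorphM f) !(rmorphXn f).
Qed.


End IdemMorph.

(** * The generators of the quotient and their relations *)

Section Generators.
Variables (F : fieldType) (d n : nat).
Implicit Types (i : 'I_n.-1) (j : 'I_n).
Local Notation R := (laurent F).
Local Notation Y := (yokonuma_hecke F d n).
Local Notation C := (ctl F d n).

Definition piY : {rmorphism yh_free F n -> Y} := quot_pi (@yh_rel F d n).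
Definition piC : {rmorphism Y -> C} := quot_pi (@ctl_rel F d n).

Definition cg i : C := piC (yh_g F d i).
Definition ct j : C := piC (yh_t F d j).

Lemma piY_rel (u v : yh_free F n) : yh_rel d (u - v) -> piY u = piY v.
Proof. by move=> h; apply/quot_piP/IdealGen. Qed.

Lemma yh_g_comm i i' : (i.+1 < i')%N || (i'.+1 < i)%N ->
  yh_g F d i * yh_g F d i' = yh_g F d i' * yh_g F d i.
Proof. by move=> far; apply: (morphM2 (f := piY)); apply: piY_rel; apply: YHComm. Qed.

Lemma cg_comm i i' : (i.+1 < i')%N || (i'.+1 < i)%N -> cg i * cg i' = cg i' * cg i.
Proof. by move=> far; exact: (morphM2 (congr1 piC (yh_g_comm far))). Qed.

Lemma yh_g_braid i i' : i' = i.+1 :> nat ->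
  yh_g F d i * yh_g F d i' * yh_g F d i = yh_g F d i' * yh_g F d i * yh_g F d i'.
Proof. by move=> e; apply: (morphM3 (f := piY)); apply: piY_rel; apply: YHBraid. Qed.

Lemma cg_braid i i' : i' = i.+1 :> nat -> cg i * cg i' * cg i = cg i' * cg i * cg i'.
Proof. by move=> e; exact: (morphM3 (congr1 piC (yh_g_braid e))). Qed.

Lemma yh_t_comm (j k : 'I_n) : yh_t F d j * yh_t F d k = yh_t F d k * yh_t F d j.
Proof. by apply: (morphM2 (f := piY)); apply: piY_rel; apply: YHTT. Qed.

Lemma ct_comm (j k : 'I_n) : ct j * ct k = ct k * ct j.
Proof. exact: (morphM2 (congr1 piC (yh_t_comm j k))). Qed.

Lemma yh_t_g i j : yh_t F d j * yh_g F d i = yh_g F d i * yh_t F d (adj i j).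
Proof. by apply: (morphM2 (f := piY)); apply: piY_rel; apply: YHTG. Qed.

Lemma ct_cg i j : ct j * cg i = cg i * ct (adj i j).
Proof. exact: (morphM2 (congr1 piC (yh_t_g i j))). Qed.

Lemma yh_t_d j : yh_t F d j ^+ d = 1.
Proof. by apply: (morphX1 (f := piY)); apply: piY_rel; apply: YHTd. Qed.

Lemma ct_d j : ct j ^+ d = 1.
Proof. exact: (morphX1 (congr1 piC (yh_t_d j))). Qed.

Lemma idem_e_yh i : piY (idem_e d (@free_t F n) i) = idem_e d (@yh_t F d n) i.
Proof. exact: (@idem_e_morph F d n _ _ piY _ i (fun=> erefl)). Qed.

Lemma idem_e_ctl i : piC (idem_e d (@yh_t F d n) i) = avg_e d ct (ldv F d) i.
Proof. exact: (@idem_e_morph F d n _ _ piC _ i (fun=> erefl)). Qed.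

Lemma yh_g_quad i : yh_g F d i ^+ 2 = alg_cst Y (laurent_q F)
  + alg_cst Y (laurent_q F - 1) * idem_e d (@yh_t F d n) i * yh_g F d i.
Proof.
have h := morph_quad (piY_rel (YHQuad F d i)).
exact: (etrans h (congr1 (fun e => _ + _ * e * _) (idem_e_yh i))).
Qed.

Lemma cg_quad i : cg i ^+ 2 = alg_cst C (laurent_q F)
  + alg_cst C (laurent_q F - 1) * avg_e d ct (ldv F d) i * cg i.
Proof.
have h := morph_quad (congr1 piC (yh_g_quad i)).
exact: (etrans h (congr1 (fun e => _ + _ * e * _) (idem_e_ctl i))).
Qed.

Lemma idem_T_ctl j : piC (idem_T F d j) = avg_T d ct (ldv F d) j.
Proof. exact: (morph_sum_pow (f := piC) _ _ erefl). Qed.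

Lemma g12_ctl (i1 i2 : 'I_n.-1) : piC (g12 F d i1 i2) = qsym cg i1 i2.
Proof. exact: (morph_sym piC). Qed.

Lemma c_qsym_kill j (i1 i2 : 'I_n.-1) :
  j = 0%N :> nat -> i1 = 0%N :> nat -> i2 = 1%N :> nat ->
  avg_T d ct (ldv F d) j * avg_e d ct (ldv F d) i1 * avg_e d ct (ldv F d) i2
    * qsym cg i1 i2 = 0.
Proof.
move=> h1 h2 h3; apply: (morph_kill (idem_T_ctl j) (idem_e_ctl i1) (idem_e_ctl i2)
  (g12_ctl i1 i2)).
rewrite -(rmorph0 piC); apply/quot_piP; rewrite subr0.
by apply/IdealGen/CTLRel.
Qed.

(** Both quotient maps are onto, so induction over the free algebra descends. *)
Lemma ctl_ind (P : C -> Prop) :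
  P 1 -> (forall x y, P x -> P y -> P (x + y)) ->
  (forall c x, P x -> P (alg_cst C c * x)) ->
  (forall i x, P x -> P (cg i * x)) ->
  (forall j x, P x -> P (ct j * x)) -> forall x, P x.
Proof.
move=> P1 PD PZ Pg Pt x.
have [y ->] : exists y, x = piC y.
  by exists (repr (x : quot_ring (@ctl_rel F d n))); apply/esym/quot_reprK.
have [z ->] : exists z, y = piY z.
  by exists (repr (y : quot_ring (@yh_rel F d n))); apply/esym/quot_reprK.
move: z => {y}{}x.
elim/free_alg_ind: x => [|x y Px Py|c x Px|[i|j] x Px].
- by rewrite (rmorph1 piY) (rmorph1 piC).
- by rewrite (rmorphD piY) (rmorphD piC); apply: PD.
- by rewrite (rmorphM piY) (rmorphM piC); apply: (PZ c).
- by rewrite (rmorphM piY) (rmorphM piC); apply: (Pg i).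
- by rewrite (rmorphM piY) (rmorphM piC); apply: (Pt j).
Qed.

End Generators.

(** * Coloured letters *)

Section LetterModel.
Variables (d n : nat) (d_gt0 : (0 < d)%N).

(* Two letters in class zero make the q-symmetrizer vanish; [n] letters in every
   other class allow words without repeated letters outside class zero. *)
Definition letter : finType := (bool + {c : 'I_d | (0 < c)%N} * 'I_n)%type.

Definition letter_class (x : letter) : 'I_d :=
  match x with inl _ => Ordinal d_gt0 | inr cm => val cm.1 end.

Lemma letter_class0 x y z : letter_class x = 0%N :> nat ->
  letter_class y = 0%N :> nat -> letter_class z = 0%N :> nat ->
  [|| x == y, x == z | y == z].
Proof.
have pos (c : {c : 'I_d | (0 < c)%N}) : val c = 0%N :> nat -> False.
  by case: c => c /= h e; rewrite e in h.
case: x => [x|[c ?]] /=; last by move/pos.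
case: y => [y|[c ?]] /=; last by move=> _ /pos.
case: z => [z|[c ?]] /=; last by move=> _ _ /pos.
by case: x y z => [] [] [].
Qed.

End LetterModel.

(** * The action on words descends to the quotient *)

Section ActionOnCtl.
Variables (F : fieldType) (d n : nat) (d_gt0 : (0 < d)%N) (om : F).
Hypothesis om_prim : d.-primitive_root om.
Local Notation R := (laurent F).
Local Notation word := {ffun 'I_n -> letter d n}.
Local Notation V := {ffun word -> R^o}.
Local Notation cl := (@letter_class d n d_gt0).
Local Notation opg := (@opg R n d (letter d n) cl (laurent_q F)).
Local Notation opt := (@opt R n d (letter d n) cl (lw om)).

Definition op_gen (x : 'I_n.-1 + 'I_n) : V -> V :=
  match x with inl i => opg i | inr j => opt j end.

Lemma op_gen_lin x a (f1 f2 : V) :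
  op_gen x (a *: f1 + f2) = a *: op_gen x f1 + op_gen x f2.
Proof. by case: x => [i|j]; [apply: opg_lin|apply: opt_lin]. Qed.

Definition act_free : raction V (yh_free F n) := free_raction op_gen_lin.

Lemma act_free_g v i : act_free v (free_g F i) = opg i v.
Proof. exact: free_ractE. Qed.

Lemma act_free_t v j : act_free v (free_t F j) = opt j v.
Proof. exact: free_ractE. Qed.

Lemma act_free_rel x : yh_rel d x -> forall v, act_free v x = 0.
Proof.
case=> [i i' far|i i' e|j k|i j|j|i] v.
- exact: (ract_g_far act_free_g).
- exact: (ract_g_braid act_free_g).
- exact: (ract_t_comm act_free_t).
- exact: (ract_t_g act_free_g act_free_t).
- exact: (ract_t_d (lw_d om_prim) act_free_t).
- exact: (ract_g_quad d_gt0 (lw_d om_prim) (lw_inv om_prim) (laurent_orth om_prim)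
    act_free_g act_free_t).
Qed.

Definition act_yh : raction V (yokonuma_hecke F d n) :=
  quot_raction act_free_rel (free_ract0 op_gen_lin).

Lemma act_yh_g v i : act_yh v (yh_g F d i) = opg i v.
Proof. by rewrite -act_free_g; apply: qact_pi (act_free_rel) (free_ract0 op_gen_lin) _
  _. Qed.

Lemma act_yh_t v j : act_yh v (yh_t F d j) = opt j v.
Proof. by rewrite -act_free_t; apply: qact_pi (act_free_rel) (free_ract0 op_gen_lin) _
  _. Qed.

Lemma act_yh0 x : act_yh 0 x = 0.
Proof. exact: free_ract0 op_gen_lin _. Qed.

Lemma act_yh_rel x : ctl_rel x -> forall v, act_yh v x = 0.
Proof.
case=> j i1 i2 h1 h2 h3 v.
exact: (ract_kill d_gt0 (lw_d om_prim) (lw_inv om_prim) (laurent_orth om_prim)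
  (@letter_class0 d n d_gt0) act_yh_g act_yh_t).
Qed.

Definition act_ctl : raction V (ctl F d n) := quot_raction act_yh_rel act_yh0.

Lemma act_ctl_g v i : act_ctl v (cg F d i) = opg i v.
Proof. by rewrite -act_yh_g; apply: qact_pi act_yh_rel act_yh0 _ _. Qed.

Lemma act_ctl_t v j : act_ctl v (ct F d j) = opt j v.
Proof. by rewrite -act_yh_t; apply: qact_pi act_yh_rel act_yh0 _ _. Qed.

End ActionOnCtl.

(** * Words separating the basis elements *)

Section SeparatingWords.
Variables (d n : nat) (d_gt0 : (0 < d)%N).
Implicit Types (psi : {ffun 'I_n -> 'I_d}) (p : 'S_n) (j : 'I_n).
Local Notation word := {ffun 'I_n -> letter d n}.
Local Notation cl := (@letter_class d n d_gt0).

Definition record_at psi p j :=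
  [forall a : 'I_n, (a < j)%N && (psi a == 0%N :> nat) ==> (p a < p j)%N].

(* Splitting the strands of colour zero into left-to-right maxima and the others
   yields two increasing sequences exactly when there is no 321-pattern. *)
Definition sep_word psi p : word :=
  [ffun j => match insub (psi j) with
             | Some c => inr (c, j)
             | None => inl (record_at psi p j)
             end].

Lemma sep_word_class psi p j : cl (sep_word psi p j) = psi j.
Proof.
rewrite ffunE; case: insubP => [c _ //|]; rewrite -eqn0Ngt => /eqP e.
by apply: ord_inj; rewrite /= e.
Qed.

(** Letters of nonzero colour carry their position and never repeat, and left-to-right maxima
    increase. If two other strands of colour zero formed an inversion, a larger earlier value of
    colour zero would complete it to a 321-pattern. *)
Lemma sep_word_incr psi p : ~~ has_pattern psi p -> incr_on (sep_word psi p) p.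
Proof.
move=> np a b ltab; rewrite !ffunE.
case: insubP => [c _ _|]; first by case: insubP => // c' _ _ [_ e];
  rewrite e ltnn in ltab.
rewrite -eqn0Ngt => za; case: insubP => [//|]; rewrite -eqn0Ngt => zb [].
have [/forallP/(_ a)|nrb e] := boolP (record_at psi p b).
  by rewrite ltab za /= => ->.
have /forallPn[a'] : ~~ record_at psi p a by rewrite e.
rewrite negb_imply -leqNgt => /andP[/andP[lta' za'] le].
rewrite ltnNge; apply/negP => leba; case/negP: np; apply/has_patternP.
have neq_p (x y : 'I_n) : (x < y)%N -> p x != p y :> nat.
  by move=> lt; apply: contraTneq lt => /ord_inj/perm_inj ->; rewrite ltnn.
exists a', a, b; split; [by rewrite lta'| |by split; apply/eqP].
by rewrite !ltn_neqAle leba le !andbT (eq_sym (p b : nat)) neq_p //= eq_sym neq_p.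
Qed.

Definition start_word psi p : word := [ffun j => sep_word psi p ((p^-1)%g j)].

Lemma start_wordE psi p : start_word psi p \o p =1 sep_word psi p.
Proof. by move=> j; rewrite /= ffunE permK. Qed.

End SeparatingWords.

(** * The basis and the dimension *)

Section Basis.
Variables (F : fieldType) (d n : nat) (d_gt0 : (0 < d)%N) (om : F).
Hypothesis om_prim : d.-primitive_root om.
Implicit Types (psi : {ffun 'I_n -> 'I_d}) (p : 'S_n).
Local Notation R := (laurent F).
Local Notation K := (ratfun F).
Local Notation C := (ctl F d n).
Local Notation iota := (val : {rmorphism laurent F -> ratfun F}).

Definition cbasis psi p : C := gbasis (@cg F d n) (@ct F d n) (ldv F d) (lwb om) psi p.

Lemma w_orth s : (s < d)%N ->
  ldv F d * \sum_(c < d) (lwb om ^+ c) ^+ s = (s == 0%N)%:R.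
Proof.
move=> lt; have := laurent_orth om_prim (Ordinal d_gt0) (Ordinal lt).
rewrite [LHS](_ : _ = ldv F d * \sum_(c < d) (lwb om ^+ c) ^+ s); last first.
  by congr (_ * _); apply: eq_bigr => c _; rewrite expr0 mul1r exprAC.
by move=> ->; rewrite -val_eqE /= eq_sym.
Qed.

(** The span contains [1] and is stable under left multiplication by the generators. *)
Lemma ctl_span x : linspan (avoiding d (@cg F d n) (@ct F d n) (ldv F d) (lwb om)) x.
Proof.
elim/(@ctl_ind F d n): x => [|x y|c x|i x|j x].
- exact: (span_avoiding1 d_gt0 (@cg_comm F d n) (@cg_braid F d n) (@ct_comm F d n)
    (@ct_cg F d n) (@ct_d F d n) (@cg_quad F d n) (@c_qsym_kill F d n)
    (laurent_qK F) (lw_inv om_prim) (lw_d om_prim) w_orth).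
- exact: SpanD.
- exact: SpanZ.
- exact: (span_avoiding_g d_gt0 (@cg_comm F d n) (@cg_braid F d n) (@ct_comm F d n)
    (@ct_cg F d n) (@ct_d F d n) (@cg_quad F d n) (@c_qsym_kill F d n)
    (laurent_qK F) (lw_inv om_prim) (lw_d om_prim) w_orth).
- exact: (span_avoiding_t d_gt0 (@ct_comm F d n) (@ct_d F d n) (lw_inv om_prim) (lw_d
    om_prim)).
Qed.

Local Notation index := ({ffun 'I_n -> 'I_d} * 'S_n)%type.
Local Notation good := [set x : index | ~~ has_pattern x.1 x.2].

Definition tbasis (x : index) : ctl_ratfun F d n :=
  tensor iota 1 (cbasis x.1 x.2 : alg_mod C).

Lemma tbasis_gen (v : ctl_ratfun F d n) :
  exists c : index -> K, v = \sum_(x in good) c x *: tbasis x.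
Proof.
elim/base_change_ind: v => [v v' [c ->] [c' ->]|a v [c ->]|m].
- exists (fun x => c x - c' x); rewrite -sumrB; apply: eq_bigr => x _.
  by rewrite scalerBl.
- exists (fun x => a * c x); rewrite scaler_sumr; apply: eq_bigr => x _.
  by rewrite scalerA.
elim: (ctl_span m) => [_ [psi [p [np ->]]]||x y _ [c ec] _ [c' ec']|a x _ [c ec]].
- exists (fun x => (x == (psi, p))%:R); rewrite (bigD1 (psi, p)) ?inE //= eqxx scale1r.
  by rewrite big1 ?addr0 // => x /andP[_ /negPf ->]; rewrite scale0r.
- exists (fun=> 0); rewrite big1 => [|x _]; last by rewrite scale0r.
  exact: tensor0.
- exists (fun x => c x + c' x); rewrite [LHS](tensorDr iota 1 (x : alg_mod C) y) ec ec'.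
  by rewrite -big_split; apply: eq_bigr => z _; rewrite scalerDl.
exists (fun x => iota a * c x).
rewrite [LHS](tensor_scale iota 1 a (x : alg_mod C)) mul1r -[iota a]mulr1 -tensorZ ec.
by rewrite scaler_sumr; apply: eq_bigr => z _; rewrite scalerA mulr1.
Qed.

Local Notation word := {ffun 'I_n -> letter d n}.
Local Notation V := {ffun word -> R^o}.
Local Notation act := (@act_ctl F d n d_gt0 om om_prim).

Definition coef (z u : word) (m : alg_mod C) : R := act (delta R z) (m : C) u.

Lemma coefD z u m m' : coef z u (m + m') = coef z u m + coef z u m'.
Proof. by rewrite /coef ractD ffunE. Qed.

Lemma coefZ z u a m : coef z u (a *: m) = a * coef z u m.
Proof. by rewrite /coef [act _ _]ractZ ffunE. Qed.

Lemma coef_basis z u psi p : coef z u (cbasis psi p) =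
  [forall j, letter_class d_gt0 (z j) == psi j]%:R *
  opw (letter_class d_gt0) (laurent_q F) (rword p) (delta R z) u.
Proof.
have := ract_basis (laurent_orth om_prim) (act_ctl_g d_gt0 om_prim) (act_ctl_t d_gt0
  om_prim) z u psi p.
by [].
Qed.

Lemma coef_sep psi p : ~~ has_pattern psi p -> exists k,
  coef (sep_word psi p) (start_word psi p) (cbasis psi p) = laurent_q F ^+ k.
Proof.
move=> np; have [||k kE] := @opw_delta_diag R n d (letter d n) (letter_class d_gt0)
    (laurent_q F) (rword p) (sep_word psi p) (start_word psi p) (rword_reduced p).
- by rewrite pword_rword; apply: sep_word_incr.
- by rewrite pword_rword; apply: start_wordE.
exists k; rewrite coef_basis kE.
have -> : [forall j, letter_class d_gt0 (sep_word psi p j) == psi j].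
  by apply/forallP => j; rewrite sep_word_class.
by rewrite mul1r.
Qed.

(** Triangularity: the colours of [sep_word] determine [psi], and since [p] is the shortest
    permutation between the two words, any other contributing element is longer. *)
Lemma coef_sep_neq psi p psi' p' : ~~ has_pattern psi p ->
  coef (sep_word psi p) (start_word psi p) (cbasis psi' p') != 0 ->
  psi' = psi /\ (p' = p \/ ninv p < ninv p')%N.
Proof.
move=> np; rewrite coef_basis.
case: forallP => [h|_]; last by rewrite mul0r eqxx.
rewrite mul1r => /opw_delta_support[v [vE le_v eq_v]]; split.
  by apply/ffunP => j; rewrite -(eqP (h j)) sep_word_class.
have incp : incr_on (start_word psi p \o p) p.
  by move=> a b lt; rewrite !start_wordE; apply: sep_word_incr.
have pv : start_word psi p \o p =1 start_word psi p \o v.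
  by move=> j; rewrite start_wordE vE.
have [le_pv eq_pv] := ninv_incr_min incp pv.
rewrite size_rword pword_rword in le_v eq_v.
have := leq_trans le_pv le_v; rewrite leq_eqVlt => /orP[/eqP e|]; last by right.
have ev : ninv v = ninv p by apply/eqP; rewrite eqn_leq le_pv andbT e.
left; have evp : p = v := eq_pv (esym ev).
by rewrite evp; apply/esym/eq_v; rewrite ev.
Qed.

(** Take a term of maximal length among those with nonzero coefficient. Its matrix coefficient,
    extended to the base change, is a power of [q] on it and vanishes on the other terms by
    triangularity. *)
Lemma tbasis_free (c : index -> K) :
  \sum_(x in good) c x *: tbasis x = 0 -> forall x, x \in good -> c x = 0.
Proof.
move=> c0 x0 gx0; apply/eqP; apply: contraT => nz0.
pose P x := (x \in good) && (c x != 0).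
have Px0 : P x0 by rewrite /P gx0 nz0.
case: (arg_maxnP (fun x : index => ninv x.2) Px0) => x /andP[gx nzx] xmax.
have np : ~~ has_pattern x.1 x.2 by move: gx; rewrite inE.
pose l := coef (sep_word x.1 x.2) (start_word x.1 x.2).
pose L : ctl_ratfun F d n -> K := bc_functional l.
have L0 : L 0 = 0 by rewrite -(scale0r (0 : ctl_ratfun F d n)) /L bc_functionalZ ?mul0r
  //; [apply: coefD|apply: coefZ].
have LD y y' : L (y + y') = L y + L y'.
  by apply: bc_functionalD; [apply: coefD|apply: coefZ].
have LZ a y : L (a *: y) = a * L y.
  by apply: bc_functionalZ; [apply: coefD|apply: coefZ].
have Lb y : L (tbasis y) = iota (l (cbasis y.1 y.2)).
  by rewrite /L bc_functional_tensor ?mul1r //; [apply: coefD|apply: coefZ].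
have := congr1 L c0; rewrite L0 (big_morph L LD L0) (bigD1 x) //= big1 ?addr0.
  rewrite LZ Lb; have [k lk] := coef_sep np; rewrite /l lk => /eqP.
  rewrite rmorphXn mulf_eq0 (negPf nzx) /= expf_eq0 => /andP[_].
  by rewrite -[_ == 0]/(qvar F == 0) (negPf (qvar_neq0 F)).
move=> y /andP[gy ney]; rewrite LZ Lb.
have [->|nzy] := eqVneq (c y) 0; first by rewrite mul0r.
have [->|] := eqVneq (l (cbasis y.1 y.2)) 0; first by rewrite rmorph0 mulr0.
case/(coef_sep_neq np) => e1 [e2|lt].
  by case/eqP: ney; rewrite [y]surjective_pairing [x]surjective_pairing e1 e2.
have le := xmax y; rewrite /P gy nzy in le.
by move: (leq_trans lt (le isT)); rewrite ltnn.
Qed.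

Lemma ctl_dim : has_dim (ctl_ratfun F d n)
  (\sum_(0 <= k < n.+1) 'C(n, k) ^ 2 * catalan k * (d - 1) ^ (n - k) * (n - k)`!)%N.
Proof.
rewrite -card_avoiding_pairs //.
exact: (has_dim_basis tbasis_free tbasis_gen).
Qed.

End Basis.

(** In a closed field [X^d - 1] splits, with distinct roots because [d] is nonzero there, and [d]
    distinct [d]-th roots of unity include a primitive one. *)
Lemma closed_prim_root (F : closedFieldType) (d : nat) :
  (0 < d)%N -> d%:R != 0 :> F -> exists om : F, d.-primitive_root om.
Proof.
move=> d_gt0 d0; pose p : {poly F} := 'X^d - 1.
have [r pE] := closed_field_poly_normal p.
rewrite (monicP _) ?monicXnsubC // scale1r in pE.
have r_unity : all d.-unity_root r by apply/allP => z; rewrite -root_prod_XsubC -pE.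
have size_r : (d < (size r).+1)%N.
  by rewrite -(size_prod_XsubC r id) -pE size_XnsubC.
have [|om] := hasP (has_prim_root d_gt0 r_unity _ size_r); last by exists om.
by rewrite -separable_prod_XsubC -pE separable_Xn_sub_1.
Qed.

Theorem theorem5p5 (R : realType) (d n : nat) (d_gt0 : (0 < d)%N) (n_gt0 : (0 < n)%N) :
  has_dim (ctl_ratfun (complex R) d n)
    (\sum_(0 <= k < n.+1)
       'C(n, k) ^ 2 * catalan k * (d - 1) ^ (n - k) * (n - k)`!)%N.
Proof.
have d0 : d%:R != 0 :> complex R by rewrite Num.Theory.pnatr_eq0 -lt0n.
have [om om_prim] := closed_prim_root d_gt0 d0.
exact: ctl_dim om_prim.
Qed.
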